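(* Let $V$ be an indecomposable Harish-Chandra module over the Virasoro algebra $\mathrm{Vir}$ on which the central element $c$ acts as a scalar $h\in\mathbb{C}$. Then at least one of the following holds: (i) $V$ is a uniformly bounded module; (ii) $V$ is a module in Category $\mathcal{O}$; (iii) $V$ is a module in Category $\mathcal{O}^-$; (iv) $V$ contains the trivial module $V(0)$ as one of its composition factors.
   Context: The Virasoro algebra $\mathrm{Vir}$ is the complex Lie algebra with basis $\{L_i, c \mid i\in\mathbb{Z}\}$ and brackets $[L_i,L_j]=(j-i)L_{i+j}+\frac{i^3-i}{12}\delta_{i,-j}\,c$ and $[L_i,c]=0$ for $i,j\in\mathbb{Z}$. A Harish-Chandra module is a $\mathrm{Vir}$-module $V$ with a decomposition $V=\bigoplus_{\lambda\in\mathbb{C}}V_\lambda$, where $V_\lambda=\{v\in V\mid L_0v=\lambda v\}$ and $\dim V_\lambda<\infty$ for all $\lambda\in\mathbb{C}$. Standing convention: $c$ acts on $V$ as a scalar $h\in\mathbb{C}$ (and $h=0$ when $V$ is uniformly bounded). $V$ is uniformly bounded if there exists $N>0$ such that $\dim V_\lambda\le N$ for all $\lambda\in\mathbb{C}$. Define a partial order on $\mathbb{C}$ by $\lambda\le\mu$ iff $\lambda-\mu$ is a nonpositive real number. $V$ is in Category $\mathcal{O}$ (respectively $\mathcal{O}^-$) if there exists $\lambda_0\in\mathbb{C}$ such that every $\lambda\in\mathbb{C}$ with $V_\lambda\neq 0$ satisfies $\lambda\le\lambda_0$ (respectively $\lambda_0\le\lambda$). $V(0)$ denotes the one-dimensional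 trivial $\mathrm{Vir}$-module. A composition factor of a (possibly infinite-length) module $V$ is a simple subquotient $A/B$, where $B\subset A\subset V$ are submodules. *)

(* Defs.v *)
From HB Require Import structures.
From mathcomp Require Import all_boot all_order all_algebra ring.
From mathcomp Require Import generic_quotient boolp classical_sets reals.
From mathcomp Require Import complex finmap.
From mathcomp Require Import monalg.

Set Implicit Arguments.
Unset Strict Implicit.
Unset Printing Implicit Defensive.

Import GRing.Theory Num.Theory.
Local Open Scope classical_set_scope.
Local Open Scope ring_scope.
Local Open Scope quotient_scope.

HB.mixin Record Lmodule_isLieAlgebra (K : comNzRingType) g
    of GRing.Lmodule K g := {
  lie_bracket : g -> g -> g;
  lie_bracket_linearl : forall y, linear (lie_bracket^~ y);
  lie_bracket_linearr : forall x, linear (lie_bracket x);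
  lie_bracketxx : forall x, lie_bracket x x = 0;
  lie_bracket_jacobi : forall x y z,
    lie_bracket x (lie_bracket y z) + lie_bracket y (lie_bracket z x)
      + lie_bracket z (lie_bracket x y) = 0
}.

#[short(type="lieAlgType")]
HB.structure Definition LieAlgebra (K : comNzRingType) :=
  {g of GRing.Lmodule K g & Lmodule_isLieAlgebra K g}.

HB.mixin Record Lmodule_isLieModule (K : comNzRingType) (g : lieAlgType K) V
    of GRing.Lmodule K V := {
  lie_act : g -> V -> V;
  lie_act_linearl : forall v, linear (lie_act^~ v);
  lie_act_linearr : forall x, linear (lie_act x);
  lie_act_bracket : forall x y v,
    lie_act (lie_bracket x y) v
      = lie_act x (lie_act y v) - lie_act y (lie_act x v)
}.

#[short(type="lieModType")]
HB.structure Definition LieModule (K : comNzRingType) (g : lieAlgType K) :=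
  {V of GRing.Lmodule K V & Lmodule_isLieModule K g V}.

HB.instance Definition _ (K : comNzRingType) (g : lieAlgType K)
    (V : lieModType g) (x : g) :=
  GRing.isLinear.Build K V V _ (lie_act x) (lie_act_linearr x).

Section Submodules.
Context {K : comNzRingType} {g : lieAlgType K}.
Implicit Type V : lieModType g.

Record submodule V := Submodule {
  submodule_set :> V -> Prop;
  submodule0 : submodule_set 0;
  submoduleP : forall a u v,
    submodule_set u -> submodule_set v -> submodule_set (a *: u + v);
  submodule_act : forall x v, submodule_set v -> submodule_set (lie_act x v)
}.

Definition lie_hom (V W : lieModType g) (f : {linear V -> W}) :=
  forall (x : g) v, f (lie_act x v) = lie_act x (f v).

Definition lie_isomorphic (V W : lieModType g) :=
  exists f : {linear V -> W}, lie_hom f /\ bijective f.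

Definition simple_module V :=
  (exists v : V, v != 0) /\
  (forall A : submodule V, A = [set 0] :> set V \/ A = setT :> set V).

Definition internal_direct_sum2 V (A B : submodule V) :=
  (forall v, exists a b, [/\ A a, B b & v = a + b]) /\ A `&` B = [set 0].

Definition indecomposable V :=
  (exists v : V, v != 0) /\
  (forall A B : submodule V, internal_direct_sum2 A B ->
     A = [set 0] :> set V \/ B = [set 0] :> set V).

End Submodules.

Section SubmoduleType.
Context {K : comNzRingType} {g : lieAlgType K} {V : lieModType g}.
Variable A : submodule V.

Definition sub_mem : {pred V} := fun v => `[< A v >].

Lemma sub_mem_submod_closed : submod_closed sub_mem.
Proof.
split; first exact/asboolP/submodule0.
by move=> a u v /asboolP Au /asboolP Av; apply/asboolP/submoduleP.
Qed.

HB.instance Definition _ :=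
  GRing.isSubmodClosed.Build K V sub_mem
    (GRing.submod_closed_semi sub_mem_submod_closed).

Definition submod_type := {v : V | v \in sub_mem}.

HB.instance Definition _ := SubType.on submod_type.
HB.instance Definition _ := [Choice of submod_type by <:].
HB.instance Definition _ := [SubChoice_isSubLmodule of submod_type by <:].

Fact submod_act_subproof x (u : submod_type) : lie_act x (val u) \in sub_mem.
Proof. by apply/asboolP/submodule_act/asboolP; exact: valP u. Qed.

Definition submod_act x (u : submod_type) : submod_type :=
  Sub (lie_act x (val u)) (submod_act_subproof x u).

Fact submod_act_linearl u : linear (submod_act^~ u).
Proof. by move=> a x y; apply: val_inj; rewrite /= lie_act_linearl. Qed.

Fact submod_act_linearr x : linear (submod_act x).
Proof. by move=> a u v; apply: val_inj; rewrite /= lie_act_linearr. Qed.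

Fact submod_act_bracket x y u :
  submod_act (lie_bracket x y) u
    = submod_act x (submod_act y u) - submod_act y (submod_act x u).
Proof. by apply: val_inj; rewrite /= lie_act_bracket. Qed.

HB.instance Definition _ := Lmodule_isLieModule.Build K g submod_type
  submod_act_linearl submod_act_linearr submod_act_bracket.

End SubmoduleType.

Section QuotientModule.
Context {K : comNzRingType} {g : lieAlgType K} {V : lieModType g}.
Variable B : submodule V.

Definition quotmod_type := Quotient.quot (sub_mem B).

HB.instance Definition _ := GRing.Zmodule.on quotmod_type.
HB.instance Definition _ := EqQuotient.on quotmod_type.

Definition quotmod_pi (v : V) : quotmod_type := \pi_quotmod_type v.

Lemma quotmod_piP u v : quotmod_pi u = quotmod_pi v <-> B (u - v).
Proof.
rewrite /quotmod_pi; split=> [/eqP|Buv].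
  by rewrite -Quotient.idealrBE => /asboolP.
by apply/eqP; rewrite -Quotient.idealrBE; apply/asboolP.
Qed.

Lemma quotmod_piD u v : quotmod_pi (u + v) = quotmod_pi u + quotmod_pi v.
Proof. exact: Quotient.pi_add. Qed.

Lemma quotmod_reprK (p : quotmod_type) : quotmod_pi (repr p) = p.
Proof. exact: reprK. Qed.

Lemma quotmod_repr_sub v : B (repr (quotmod_pi v) - v).
Proof. by apply/quotmod_piP; rewrite quotmod_reprK. Qed.

Definition quotmod_scale (a : K) (p : quotmod_type) := quotmod_pi (a *: repr p).

Lemma quotmod_scaleE a v : quotmod_scale a (quotmod_pi v) = quotmod_pi (a *: v).
Proof.
apply/quotmod_piP; rewrite -scalerBr -[_ *: _]addr0.
by apply: submoduleP; [exact: quotmod_repr_sub | exact: submodule0].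
Qed.

Fact quotmod_scaleA a b p :
  quotmod_scale a (quotmod_scale b p) = quotmod_scale (a * b) p.
Proof. by rewrite -[p]quotmod_reprK !quotmod_scaleE scalerA. Qed.

Fact quotmod_scale1 : left_id 1 quotmod_scale.
Proof. by move=> p; rewrite -[p]quotmod_reprK quotmod_scaleE scale1r. Qed.

Fact quotmod_scaleDr : right_distributive quotmod_scale +%R.
Proof.
move=> a p q; rewrite -[p]quotmod_reprK -[q]quotmod_reprK.
by rewrite -quotmod_piD !quotmod_scaleE scalerDr quotmod_piD.
Qed.

Fact quotmod_scaleDl p : {morph quotmod_scale^~ p : a b / a + b}.
Proof.
move=> a b; rewrite -[p]quotmod_reprK !quotmod_scaleE scalerDl.
exact: quotmod_piD.
Qed.

HB.instance Definition _ := GRing.Zmodule_isLmodule.Build K quotmod_type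
  quotmod_scaleA quotmod_scale1 quotmod_scaleDr quotmod_scaleDl.

Lemma quotmod_pi_linear : linear quotmod_pi.
Proof. by move=> a u v; rewrite quotmod_piD -quotmod_scaleE. Qed.

HB.instance Definition _ :=
  GRing.isLinear.Build K V quotmod_type _ quotmod_pi quotmod_pi_linear.

Definition quotmod_act (x : g) (p : quotmod_type) :=
  quotmod_pi (lie_act x (repr p)).

Lemma quotmod_actE x v :
  quotmod_act x (quotmod_pi v) = quotmod_pi (lie_act x v).
Proof.
apply/quotmod_piP.
rewrite -linearB.
exact/submodule_act/quotmod_repr_sub.
Qed.

Fact quotmod_act_linearl p : linear (quotmod_act^~ p).
Proof.
move=> a x y; rewrite -[p]quotmod_reprK !quotmod_actE lie_act_linearl.
exact: quotmod_pi_linear.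
Qed.

Fact quotmod_act_linearr x : linear (quotmod_act x).
Proof.
move=> a p q; rewrite -[p]quotmod_reprK -[q]quotmod_reprK.
by rewrite -quotmod_pi_linear !quotmod_actE lie_act_linearr quotmod_pi_linear.
Qed.

Fact quotmod_act_bracket x y p :
  quotmod_act (lie_bracket x y) p
    = quotmod_act x (quotmod_act y p) - quotmod_act y (quotmod_act x p).
Proof.
by rewrite -[p]quotmod_reprK !quotmod_actE lie_act_bracket linearB.
Qed.

HB.instance Definition _ := Lmodule_isLieModule.Build K g quotmod_type
  quotmod_act_linearl quotmod_act_linearr quotmod_act_bracket.

End QuotientModule.

Section Subquotients.
Context {K : comNzRingType} {g : lieAlgType K} {V : lieModType g}.

Program Definition restrict_submodule (A B : submodule V) :
    submodule (submod_type A) :=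
  @Submodule K g (submod_type A) (fun u => B (val u)) _ _ _.
Next Obligation. exact: submodule0. Qed.
Next Obligation. exact: submoduleP. Qed.
Next Obligation. exact: submodule_act. Qed.

(* Meant for B contained in A; in general this is A / (A :&: B). *)
Definition subquotient (A B : submodule V) : lieModType g :=
  quotmod_type (restrict_submodule A B).

Definition composition_factor (M : lieModType g) : Prop :=
  exists A B : submodule V,
    [/\ B `<=` A, simple_module (subquotient A B)
      & lie_isomorphic (subquotient A B) M].

End Subquotients.
Arguments composition_factor {K g} V M.

Section TrivialModule.
Context {K : comNzRingType} (g : lieAlgType K).

Definition trivial_module_type := K^o.
HB.instance Definition _ := GRing.Lmodule.on trivial_module_type.

Definition trivial_act (x : g) (v : trivial_module_type) :
  trivial_module_type := 0.

Fact trivial_act_linearl v : linear (trivial_act^~ v).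
Proof. by move=> a x y; rewrite /trivial_act scaler0 addr0. Qed.

Fact trivial_act_linearr x : linear (trivial_act x).
Proof. by move=> a u v; rewrite /trivial_act scaler0 addr0. Qed.

Fact trivial_act_bracket x y v :
  trivial_act (lie_bracket x y) v
    = trivial_act x (trivial_act y v) - trivial_act y (trivial_act x v).
Proof. by rewrite /trivial_act subr0. Qed.

HB.instance Definition _ := Lmodule_isLieModule.Build K g trivial_module_type
  trivial_act_linearl trivial_act_linearr trivial_act_bracket.

Definition trivial_module : lieModType g := trivial_module_type.

End TrivialModule.

Section LinearExtension.
Context {K : comNzRingType} {I : choiceType} {V : lmodType K}.

Definition linear_extension (f : I -> V) (x : {malg K[I]}) : V :=
  \sum_(i <- msupp x) x@_i *: f i.

Lemma linear_extensionEw f x (d : {fset I}) :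
  (msupp x `<=` d)%fset -> linear_extension f x = \sum_(i <- d) x@_i *: f i.
Proof.
move=> xd; apply: big_fset_incl => // i _ /mcoeff_outdom ->.
by rewrite scale0r.
Qed.

Lemma linear_extension_linear f : linear (linear_extension f).
Proof.
move=> a x y; pose d := (msupp (a *: x + y) `|` (msupp x `|` msupp y))%fset.
rewrite !(@linear_extensionEw f _ d) ?fsubsetUl//; last 2 first.
- by apply: fsubsetU; rewrite fsubsetUr orbT.
- by apply: fsubsetU; rewrite fsubsetUl orbT.
rewrite scaler_sumr -big_split /=; apply: eq_bigr => i _.
by rewrite mcoeffD mcoeffZ scalerDl scalerA.
Qed.

HB.instance Definition _ f :=
  GRing.isLinear.Build K {malg K[I]} V _ (linear_extension f)
    (linear_extension_linear f).

Lemma linear_extensionU f i : linear_extension f << i >> = f i.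
Proof.
rewrite (@linear_extensionEw f _ [fset i]%fset) ?msuppU_le//.
by rewrite big_seq_fset1 mcoeffUU scale1r.
Qed.

Lemma malg_linear_eq0 (f : {malg K[I]} -> V) :
  linear f -> (forall i, f << i >> = 0) -> forall x, f x = 0.
Proof.
move=> lf f0; pose fL := GRing.isLinear.Build K {malg K[I]} V _ f lf.
pose F : {linear {malg K[I]} -> V} := HB.pack f fL.
move=> x; rewrite -[f x]/(F x) [x]monalgE raddf_sum big1// => i _.
have -> : << x@_i *g i >> = x@_i *: << i >> :> {malg K[I]}.
  by apply/malgP => j; rewrite mcoeffZ !mcoeffU mulrnAr mulr1.
by rewrite -[LHS]/(f _) (GRing.scalable_linear lf) f0 /= scaler0.
Qed.

End LinearExtension.

Section Virasoro.
Variable K : numFieldType.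

(* The free module on option int: Some i indexes L_i, None indexes c. *)
Definition vir : Type := {malg K[option int]}.
HB.instance Definition _ := GRing.Lmodule.on vir.

Definition virL (i : int) : vir := << Some i >>.
Definition virC : vir := << None >>.

Definition vir_basis_bracket (a b : option int) : vir :=
  match a, b with
  | Some i, Some j =>
      (j - i)%:~R *: virL (i + j)
      + (if i == - j then (i ^+ 3 - i)%:~R / 12%:R else 0) *: virC
  | _, _ => 0
  end.

Definition vir_bracket (x y : vir) : vir :=
  linear_extension (fun a => linear_extension (vir_basis_bracket a) y) x.

Lemma vir_bracketE x y :
  vir_bracket x y = \sum_(a <- msupp x) \sum_(b <- msupp y)
                      (x@_a * y@_b) *: vir_basis_bracket a b.
Proof.
apply: eq_bigr => a _; rewrite scaler_sumr.
by apply: eq_bigr => b _; rewrite scalerA.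
Qed.

Fact vir_bracket_linearl y : linear (vir_bracket^~ y).
Proof. by move=> a x x'; rewrite /vir_bracket linearP. Qed.

Fact vir_bracket_linearr x : linear (vir_bracket x).
Proof.
move=> a y y'; rewrite /vir_bracket.
under [LHS]eq_bigr do rewrite linearP scalerDr scalerA mulrC -scalerA.
by rewrite big_split /= -scaler_sumr.
Qed.

HB.instance Definition _ x :=
  GRing.isLinear.Build K vir vir _ (vir_bracket x) (vir_bracket_linearr x).

Lemma vir_bracket_basis a b :
  vir_bracket << a >> << b >> = vir_basis_bracket a b.
Proof. by rewrite /vir_bracket !linear_extensionU. Qed.

Fact vir_basis_bracketC a b :
  vir_basis_bracket a b + vir_basis_bracket b a = 0.
Proof.
case: a b => [i|] [j|] /=; rewrite ?addr0//.
rewrite [j + i]addrC addrACA -!scalerDl -intrD.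
have -> : j - i + (i - j) = 0 by ring.
have -> : (j == - i) = (i == - j) by rewrite -eqr_oppLR eq_sym.
rewrite scale0r add0r; case: eqP => [->|_]; last by rewrite addr0 scale0r.
rewrite -mulrDl -intrD.
have -> : (- j) ^+ 3 - - j + (j ^+ 3 - j) = 0 by ring.
by rewrite mul0r scale0r.
Qed.

Fact vir_bracketC x y : vir_bracket x y + vir_bracket y x = 0.
Proof.
move: x; apply: malg_linear_eq0 => [a x x'|a].
  by rewrite vir_bracket_linearl linearP scalerDr addrACA.
move: y; apply: malg_linear_eq0 => [b y y'|b].
  by rewrite vir_bracket_linearl linearP scalerDr addrACA.
by rewrite !vir_bracket_basis vir_basis_bracketC.
Qed.

Fact vir_bracketxx x : vir_bracket x x = 0.
Proof.
have /eqP := vir_bracketC x x.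
by rewrite -mulr2n -scaler_nat scaler_eq0 pnatr_eq0 => /eqP.
Qed.

Fact vir_bracketCr x : vir_bracket x virC = 0.
Proof.
move: x; apply: malg_linear_eq0 => [|a]; first exact: vir_bracket_linearl.
by rewrite vir_bracket_basis; case: a.
Qed.

Fact vir_bracketCl x : vir_bracket virC x = 0.
Proof. by have := vir_bracketC virC x; rewrite vir_bracketCr addr0. Qed.

Lemma vir_bracketLL i j :
  vir_bracket (virL i) (virL j) = (j - i)%:~R *: virL (i + j)
    + (if i == - j then (i ^+ 3 - i)%:~R / 12%:R else 0) *: virC.
Proof. exact: vir_bracket_basis. Qed.

Fact vir_bracketLLL i j k :
  vir_bracket (virL i) (vir_bracket (virL j) (virL k))
    = ((k - j) * (j + k - i))%:~R *: virL (i + j + k)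
      + (if i + j + k == 0 then ((k - j) * (i ^+ 3 - i))%:~R / 12%:R else 0)
        *: virC.
Proof.
rewrite (vir_bracketLL j k) linearD !linearZ_LR /= vir_bracketCr scaler0 addr0.
rewrite vir_bracketLL scalerDr !scalerA -intrM addrA.
congr (_ *: _ + _ *: _).
rewrite -addr_eq0 addrA; case: eqP => _; last by rewrite mulr0.
by rewrite mulrA -intrM.
Qed.

Fact vir_jacobi x y z :
  vir_bracket x (vir_bracket y z) + vir_bracket y (vir_bracket z x)
    + vir_bracket z (vir_bracket x y) = 0.
Proof.
move: x; apply: malg_linear_eq0 => [a x x'|a].
  rewrite ?(vir_bracket_linearl, linearP) /=.
  by rewrite !scalerDr [X in X + _ = _]addrACA [LHS]addrACA.
move: y; apply: malg_linear_eq0 => [b y y'|b].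
  rewrite ?(vir_bracket_linearl, linearP) /=.
  by rewrite !scalerDr [X in X + _ = _]addrACA [LHS]addrACA.
move: z; apply: malg_linear_eq0 => [c z z'|c].
  rewrite ?(vir_bracket_linearl, linearP) /=.
  by rewrite !scalerDr [X in X + _ = _]addrACA [LHS]addrACA.
case: a b c => [i|] [j|] [k|];
  rewrite -?/virC ?vir_bracketCr ?vir_bracketCl ?linear0 ?addr0//.
rewrite -!/(virL _) !vir_bracketLLL.
have -> : j + k + i = i + j + k by ring.
have -> : k + i + j = i + j + k by ring.
rewrite [X in X + _ = _]addrACA [LHS]addrACA -!scalerDl -!intrD.
have -> : (k - j) * (j + k - i) + (i - k) * (k + i - j)
          + (j - i) * (i + j - k) = 0 by ring.
rewrite scale0r add0r; case: eqP => [|_]; last by rewrite !addr0 scale0r.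
move=> /eqP; rewrite addrC addr_eq0 => /eqP ->.
rewrite -!mulrDl -!intrD.
set n := (X in X%:~R); have -> : n = 0 by rewrite /n; ring.
by rewrite mul0r scale0r.
Qed.

HB.instance Definition _ := Lmodule_isLieAlgebra.Build K vir
  vir_bracket_linearl vir_bracket_linearr vir_bracketxx vir_jacobi.

End Virasoro.

Section WeightModules.
Context {K : numFieldType} {V : lieModType (vir K)}.

Definition central_charge (h : K) := forall v : V, lie_act (virC K) v = h *: v.

Definition weight_space (l : K) : set V :=
  [set v | lie_act (virL K 0) v = l *: v].

Definition is_basis (W : set V) n (e : 'I_n -> V) :=
  [/\ forall i, W (e i),
      forall v, W v -> exists a : 'I_n -> K, v = \sum_i a i *: e i
    & forall a : 'I_n -> K, \sum_i a i *: e i = 0 -> forall i, a i = 0].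

Definition has_dim (W : set V) n := exists e : 'I_n -> V, is_basis W e.

Definition internal_direct_sum (W : K -> set V) :=
  (forall v, exists (s : seq K) (f : K -> V),
     [/\ uniq s, forall l, W l (f l) & v = \sum_(l <- s) f l]) /\
  (forall (s : seq K) (f : K -> V), uniq s -> (forall l, W l (f l)) ->
     \sum_(l <- s) f l = 0 -> forall l, l \in s -> f l = 0).

Definition harish_chandra :=
  internal_direct_sum weight_space /\
  forall l, exists n, has_dim (weight_space l) n.

Definition uniformly_bounded :=
  exists2 N : nat, (0 < N)%N &
    forall l, exists2 n, (n <= N)%N & has_dim (weight_space l) n.

(* For K = R[i], l <= m means that m - l is a nonnegative real (lecE). *)
Definition category_O :=
  exists l0 : K, forall l, weight_space l <> [set 0] -> l <= l0.

Definition category_Om :=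
  exists l0 : K, forall l, weight_space l <> [set 0] -> l0 <= l.

End WeightModules.
Arguments central_charge {K} V h.
Arguments harish_chandra {K} V.
Arguments uniformly_bounded {K} V.
Arguments category_O {K} V.
Arguments category_Om {K} V.

(* Main.v *)
(* Up to splitting off cosets of Z, V = (+)_n V_n with V_n of weight lam + n.
   Finite-dimensionality of the V_n forces the vectors killed by all L_i, i >> 0,
   to lie in a largest submodule P with weights bounded above.  On V / P the pair
   (L_n, L_(n+1)) is injective, so its graded pieces have bounded dimension in low
   degrees.  The submodule C generated by the V_n of large degree n satisfies the
   dual property (V_m is reached by L_(-n) and L_(-n-1)), hence its low graded
   pieces are bounded as well.  But a singular vector of weight mu has a submodule
   with unbounded dimensions unless mu = h = 0, where it produces a trivial
   composition factor.  Hence without such a factor V = P (+) C.  By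
   indecomposability V = P lies in Category O, or P = 0; applying this also to the
   twist L_i |-> - L_(-i), one is left with the case in which no nonzero vector is
   killed by all L_i, i >> 0, or by all L_i, i << 0, and then V is uniformly
   bounded. *)

Require Import Defs.
From HB Require Import structures.
From mathcomp Require Import all_boot all_order all_algebra.
From mathcomp Require Import boolp reals complex.
From mathcomp Require Import classical_sets monalg.
From mathcomp Require Import ring zify.

Set Implicit Arguments.
Unset Strict Implicit.
Unset Printing Implicit Defensive.

Import Order.TTheory GRing.Theory Num.Theory.
Local Open Scope ring_scope.

(** * Subspaces, spans and coordinates *)

Section LinearAlgebra.
Context {K : fieldType} {V : lmodType K}.
Implicit Types (S T X : V -> Prop).

Definition subspace S := S 0 /\ forall a u v, S u -> S v -> S (a *: u + v).

Lemma subspaceD S u v : subspace S -> S u -> S v -> S (u + v).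
Proof. by move=> [_ lS] Su Sv; rewrite -[u]scale1r; apply: lS. Qed.

Lemma subspaceZ S a u : subspace S -> S u -> S (a *: u).
Proof. by move=> [S0 lS] Su; rewrite -[_ *: _]addr0; apply: lS. Qed.

Lemma subspaceN S u : subspace S -> S u -> S (- u).
Proof. by move=> lS Su; rewrite -scaleN1r; apply: subspaceZ. Qed.

Lemma subspaceB S u v : subspace S -> S u -> S v -> S (u - v).
Proof. by move=> lS Su Sv; apply: subspaceD => //; apply: subspaceN. Qed.

Lemma subspace_sum S (I : eqType) (r : seq I) (P : pred I) (f : I -> V) :
  subspace S -> (forall i, i \in r -> P i -> S (f i)) ->
  S (\sum_(i <- r | P i) f i).
Proof.
move=> lS Sf; rewrite big_seq_cond; apply: big_ind => //.
- by case: lS.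
- by move=> u v; apply: subspaceD.
- by move=> i /andP[]; apply: Sf.
Qed.

Lemma subspaceZr S a u : subspace S -> a != 0 -> S (a *: u) -> S u.
Proof.
by move=> lS a0 /(subspaceZ a^-1 lS); rewrite scalerA mulVf// scale1r.
Qed.

Lemma subspaceDr S u v : subspace S -> S u -> S (u + v) -> S v.
Proof. by move=> lS Su /(subspaceB lS)/(_ Su); rewrite addrAC subrr add0r. Qed.

Definition sum_space S T v := exists x y, [/\ S x, T y & v = x + y].

Lemma subspace_sum_space S T :
  subspace S -> subspace T -> subspace (sum_space S T).
Proof.
move=> lS lT; split; first by exists 0, 0; rewrite addr0; case: lS; case: lT.
move=> a _ _ [x [y [Sx Ty ->]]] [x' [y' [Sx' Ty' ->]]].
exists (a *: x + x'), (a *: y + y'); split; [exact: lS.2|exact: lT.2|].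
by rewrite scalerDr addrACA.
Qed.

Lemma sum_spacel S T v : subspace T -> S v -> sum_space S T v.
Proof. by move=> [T0 _] Sv; exists v, 0; rewrite addr0. Qed.

Lemma sum_spacer S T v : subspace S -> T v -> sum_space S T v.
Proof. by move=> [S0 _] Tv; exists 0, v; rewrite add0r. Qed.

Definition span S v := forall T, subspace T -> (forall x, S x -> T x) -> T v.

Lemma span_subspace S : subspace (span S).
Proof.
by split=> [T []//|a u v Su Sv T lT ST]; apply: lT.2; [exact: Su|exact: Sv].
Qed.

Lemma span_in S v : S v -> span S v.
Proof. by move=> Sv T _; apply. Qed.

Lemma dependence r d (A : 'M[K]_(r, d)) :
  (d < r)%N -> exists2 c : 'rV_r, c != 0 & c *m A = 0.
Proof.
move=> dr; have /rowV0Pn[c /sub_kermxP cA c0] : kermx A != 0.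
  by rewrite -mxrank_eq0 mxrank_ker -lt0n subn_gt0 (leq_ltn_trans (rank_leq_col A)).
by exists c.
Qed.

Lemma span_coord r d (g : 'I_d -> V) (u : 'I_r -> V) :
  (forall i, exists a : 'I_d -> K, u i = \sum_j a j *: g j) ->
  exists A : 'M[K]_(r, d), forall c : 'rV_r,
    \sum_i c 0 i *: u i = \sum_j (c *m A) 0 j *: g j.
Proof.
move=> /choice[a ua]; exists (\matrix_(i, j) a i j) => c.
under eq_bigr do rewrite ua scaler_sumr.
rewrite exchange_big; apply: eq_bigr => j _ /=.
rewrite mxE scaler_suml; apply: eq_bigr => i _.
by rewrite mxE scalerA.
Qed.

Lemma max_support r (c : 'rV[K]_r) : c != 0 ->
  exists2 j, c 0 j != 0 & forall i : 'I_r, (j < i)%N -> c 0 i = 0.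
Proof.
move=> /rV0Pn[i0 ci0].
case: (@arg_maxnP _ i0 (fun i => c 0 i != 0) (fun i => i : nat) ci0) => j cj jmax.
exists j => // i ji; apply/eqP; apply: contraTT ji => /jmax.
by rewrite -leqNgt.
Qed.

Lemma min_support r (c : 'rV[K]_r) : c != 0 ->
  exists2 j, c 0 j != 0 & forall i : 'I_r, (i < j)%N -> c 0 i = 0.
Proof.
move=> /rV0Pn[i0 ci0].
case: (@arg_minnP _ i0 (fun i => c 0 i != 0) (fun i => i : nat) ci0) => j cj jmin.
exists j => // i ji; apply/eqP; apply: contraTT ji => /jmin.
by rewrite -leqNgt.
Qed.

Lemma subspace_pivot S r (c : 'rV[K]_r) (x : 'I_r -> V) j : subspace S ->
  c 0 j != 0 -> (forall i, i != j -> c 0 i = 0 \/ S (x i)) ->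
  S (\sum_i c 0 i *: x i) -> S (x j).
Proof.
move=> lS cj Sx; rewrite (bigD1 j)//= addrC => Ssum.
apply: (subspaceZr lS cj); move: Ssum; apply: subspaceDr => //.
apply: subspace_sum => // i _ /Sx[->|]; last exact: subspaceZ.
by rewrite scale0r; case: lS.
Qed.

End LinearAlgebra.

(** Take a matrix of maximal rank among those whose row space lies in [X]: stacking a further vector
    of [X] onto it cannot raise the rank, so that vector is already in the row space. *)
Lemma subspace_rowspace (K : fieldType) d (X : 'rV[K]_d -> Prop) :
  subspace X -> exists A : 'M[K]_d, forall c, X c <-> (c <= A)%MS.
Proof.
move=> lX.
pose Q k := `[< exists A : 'M[K]_d, (forall c, (c <= A)%MS -> X c) /\ \rank A = k >].
have exQ : exists k, Q k.
  exists 0%N; apply/asboolP; exists 0; split; last exact: mxrank0.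
  by move=> c; rewrite submx0 => /eqP ->; case: lX.
have ubQ k : Q k -> (k <= d)%N by move=> /asboolP[A [_ <-]]; apply: rank_leq_row.
case: (ex_maxnP exQ ubQ) => k /asboolP[A [AX rA]] kmax.
exists A => c; split=> [Xc|]; last exact: AX.
have /kmax : Q (\rank (A + c)%MS).
  apply/asboolP; exists (A + c)%MS; split=> // u /sub_addsmxP[[a b] /= ->].
  apply: subspaceD => //; first by apply: AX; apply: submxMl.
  by rewrite [b]mx11_scalar mul_scalar_mx; apply: subspaceZ.
rewrite -rA => rk.
have : (A + c <= A)%MS by rewrite -(geq_leqif (mxrank_leqif_sup (addsmxSl A c))).
by apply: submx_trans; apply: addsmxSr.
Qed.

(** Pull [X] back to coordinate vectors, where it is the row space of a matrix, and read off one
    entry of the product with the cokernel of that matrix. The family [e] may be dependent: two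
    coordinate vectors of one element differ by a relation, which the cokernel kills because [X]
    contains 0. *)
Lemma separating_functional (K : fieldType) (V : lmodType K) (W X : V -> Prop)
    d (e : 'I_d -> V) v0 :
  subspace X -> subspace W ->
  (forall v, W v -> exists a : 'I_d -> K, v = \sum_i a i *: e i) ->
  W v0 -> ~ X v0 ->
  exists f : V -> K,
    [/\ forall a u v, W u -> W v -> f (a *: u + v) = a * f u + f v,
        forall v, W v -> X v -> f v = 0 & f v0 != 0].
Proof.
move=> lX lW eW Wv0 nXv0.
pose lc (c : 'rV[K]_d) := \sum_i c 0 i *: e i.
have lcl a c c' : lc (a *: c + c') = a *: lc c + lc c'.
  rewrite /lc scaler_sumr -big_split; apply: eq_bigr => i _.
  by rewrite /= !mxE scalerDl scalerA.
have /subspace_rowspace[A AX] : subspace (fun c => X (lc c)).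
  split=> [|a c c' Xc Xc']; last by rewrite lcl; apply: lX.2.
  by rewrite /lc big1; [case: lX|move=> i _; rewrite mxE scale0r].
have {}eW v : exists c, W v -> v = lc c.
  have [/eW[a ->]|] := pselect (W v); last by exists 0.
  exists (\row_i a i) => _; apply: eq_bigr => i _; by rewrite mxE.
have [co coW] := choice eW.
have : co v0 *m cokermx A != 0.
  by rewrite -submxE; apply/negP => /AX; rewrite -coW.
move=> /rV0Pn[j fj].
have f0 c : X (lc c) -> (c *m cokermx A) 0 j = 0.
  by move=> /AX; rewrite submxE => /eqP ->; rewrite mxE.
exists (fun v => (co v *m cokermx A) 0 j); split=> //.
(* The chosen coordinates [co] need not be linear, but their defect represents the zero vector. *)
- move=> a u v Wu Wv; apply/eqP; rewrite -subr_eq0; apply/eqP.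
  have -> : (co (a *: u + v) *m cokermx A) 0 j
     - (a * (co u *m cokermx A) 0 j + (co v *m cokermx A) 0 j) =
     (((-1) *: (a *: co u + co v) + co (a *: u + v)) *m cokermx A) 0 j.
    rewrite !mulmxDl -!scalemxAl mulmxDl -scalemxAl !mxE; ring.
  apply: f0; rewrite !lcl -!coW// ?scaleN1r ?addNr; first by case: lX.
  exact: lW.2.
- by move=> v Wv Xv; apply: f0; rewrite -coW.
Qed.

(** * Eventual nonvanishing of polynomials, and numerical semigroups *)

Lemma eventually_nonroot (K : numFieldType) (p : {poly K}) :
  p != 0 -> exists n0, forall n, (n0 <= n)%N -> p.[n%:R] != 0.
Proof.
elim: (size p) {-2}p (leqnn (size p)) => [q|m IH q sq q0].
  by rewrite leqn0 size_poly_eq0 => ->.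
have [[n qn]|nroot] := pselect (exists n : nat, root q n%:R); last first.
  by exists 0%N => n _; apply/negP => qn; apply: nroot; exists n.
have /factor_theorem[g gE] := qn.
have g0 : g != 0 by apply: contraNneq q0 => g0; rewrite gE g0 mul0r.
have sg : (size g <= m)%N.
  by move: sq; rewrite gE size_Mmonic ?monicXsubC// size_XsubC addn2.
have [n0 gn0] := IH g sg g0.
exists (maxn n0 n.+1) => k; rewrite geq_max => /andP[k1 k2].
rewrite gE hornerM mulf_neq0 ?gn0// hornerXsubC subr_eq0 eqr_nat.
by rewrite gtn_eqF.
Qed.

Lemma eventually_cubic_neq0 (K : numFieldType) (a b c : K) :
  [|| a != 0, b != 0 | c != 0] -> exists n0, forall n : nat, (n0 <= n)%N ->
    a * n%:R + b * n%:R ^+ 2 + c * n%:R ^+ 3 != 0.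
Proof.
move=> abc; pose p : {poly K} := a%:P * 'X + b%:P * 'X^2 + c%:P * 'X^3.
have p0 : p != 0.
  move: abc; apply: contraTneq => p0.
  have := congr1 (fun q : {poly K} => (q`_1, q`_2, q`_3)) p0.
  by rewrite !coefE /= !(mulr0, mulr1, addr0, add0r) => -[-> -> ->]; rewrite eqxx.
have [n0 pn] := eventually_nonroot p0; exists n0 => n /pn.
by rewrite !hornerE.
Qed.

(** Only sums of distinct indices are allowed, because [[L_i, L_i] = 0] produces nothing. Starting
    from [n + n.+1] keeps the running total larger than either generator, so each further addition
    of [n] or [n.+1] is legitimate. *)
Lemma numerical_semigroup (J : nat -> Prop) n : (0 < n)%N -> J n -> J n.+1 ->
  (forall i j, (i < j)%N -> J i -> J j -> J (i + j)%N) ->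
  exists k, forall i, (k <= i)%N -> J i.
Proof.
move=> n0 Jn JSn JD.
have J1 b : (J (n + n.+1 + b * n.+1))%N.
  elim: b => [|b IH]; first by rewrite mul0n addn0; apply: JD.
  have := JD n.+1 (n + n.+1 + b * n.+1)%N.
  have -> : (n.+1 + (n + n.+1 + b * n.+1) = n + n.+1 + b.+1 * n.+1)%N by nia.
  apply=> //; lia.
have J2 a b : (J (n + n.+1 + b * n.+1 + a * n))%N.
  elim: a => [|a IH]; first by rewrite mul0n addn0.
  have := JD n (n + n.+1 + b * n.+1 + a * n)%N.
  have -> : (n + (n + n.+1 + b * n.+1 + a * n) =
             n + n.+1 + b * n.+1 + a.+1 * n)%N by nia.
  apply=> //; lia.
exists (n + n.+1 + n * n)%N => i ki.
pose t := (i - (n + n.+1))%N; have tE : (i = n + n.+1 + t)%N by rewrite /t; nia.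
have tn : (n * n <= t)%N by lia.
have tq := divn_eq t n.
have rn : (t %% n < n)%N by rewrite ltn_mod.
have qn : (n <= t %/ n)%N by rewrite leq_divRL.
(* With [t = q n + r] and [r < n <= q], one has [t = (q - r) n + r (n + 1)]. *)
have := J2 (t %/ n - t %% n)%N (t %% n)%N.
suff -> : (n + n.+1 + t %% n * n.+1 + (t %/ n - t %% n) * n = i)%N by [].
have : (t %% n * n <= t %/ n * n)%N.
  by rewrite leq_mul2r (ltnW (leq_trans rn qn)) orbT.
rewrite tE [in RHS]tq mulnBl mulnS; lia.
Qed.

(** * Graded actions of the Virasoro algebra *)

Section GradedAction.
Context {K : numFieldType} {V : lmodType K}.
Variables (L : int -> {linear V -> V}) (h lam : K).
Implicit Types (S T B : V -> Prop).

Definition cocycle (i j : int) : K :=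
  if i == - j then (i ^+ 3 - i)%:~R / 12%:R * h else 0.

Definition degree_space (n : int) (v : V) : Prop :=
  L 0 v = (lam + n%:~R) *: v.
Local Notation W := degree_space.

(** Stated for a bare family of operators instead of a [lieModType], so that all results also apply
    to the twisted family [flip_op L]. Here [comp n] is the projection onto degree [n]. *)
Record graded_action (comp : int -> {linear V -> V}) : Prop := GradedAction {
  act_swap : forall i j v, L i (L j v) =
    L j (L i v) + (j - i)%:~R *: L (i + j) v + cocycle i j *: v;
  comp_degree : forall n v, W n (comp n v);
  comp_id : forall n v, W n v -> comp n v = v;
  comp_neq : forall m n v, W m v -> m != n -> comp n v = 0;
  degree_span : forall v, span (fun x => exists n, W n x) v;
  degree_fin : forall n, exists d (e : 'I_d -> V), (forall i, W n (e i)) /\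
    forall v, W n v -> exists a : 'I_d -> K, v = \sum_i a i *: e i
}.

Variable comp : int -> {linear V -> V}.
Hypothesis G : graded_action comp.

Lemma subspace_degree n : subspace (W n).
Proof.
split; first by rewrite /W linear0 scaler0.
by move=> a u v Wu Wv; rewrite /W linearP Wu Wv scalerDr !scalerA mulrC.
Qed.

Lemma cocycle0l i : cocycle 0 i = 0.
Proof. by rewrite /cocycle; case: ifP => // _; rewrite expr0n subr0 !mul0r. Qed.

Lemma cocycle_neq i j : i + j != 0 -> cocycle i j = 0.
Proof. by rewrite /cocycle -addr_eq0 => /negbTE ->. Qed.

Lemma degree_act n i v : W n v -> W (n + i) (L i v).
Proof.
move=> Wv; rewrite /W (act_swap G) cocycle0l scale0r addr0 Wv subr0 add0r.
by rewrite linearZ -scalerDl intrD addrA.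
Qed.

Lemma degree_act_eq m n i v : W n v -> m = n + i -> W m (L i v).
Proof. by move=> Wv ->; apply: degree_act. Qed.

Lemma comp_act n i v : comp n (L i v) = L i (comp (n - i) v).
Proof.
apply: (degree_span G v (T := fun v => comp n (L i v) = L i (comp (n - i) v))).
  split; first by rewrite !linear0.
  by move=> a u w hu hw; rewrite !linearP hu hw.
move=> x [m Wx]; have [<-|mn] := eqVneq (m + i) n.
  by rewrite addrK (comp_id G (degree_act i Wx)) (comp_id G Wx).
rewrite (comp_neq G (degree_act i Wx) mn) (comp_neq G Wx) ?linear0//.
by rewrite -(inj_eq (addIr i)) subrK.
Qed.

Lemma comp_eq0 n v : W n v -> comp n v = 0 -> v = 0.
Proof. by move=> Wv; rewrite (comp_id G Wv). Qed.

Lemma comp_sum v : exists s : seq int,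
  uniq s /\ v = \sum_(n <- s) comp n v.
Proof.
pose s M : seq int := [seq i%:Z - M%:Z | i <- iota 0 M.*2].
have us M : uniq (s M) by rewrite map_inj_uniq ?iota_uniq// => i j; lia.
(* [s N] lists the integers of [[-N, N)]; asking for all large [N] makes the property pass to linear
   combinations. *)
suff [M vE] : exists M, forall N, (M <= N)%N -> v = \sum_(n <- s N) comp n v.
  by exists (s M); split; [exact: us|exact: vE].
apply: (degree_span G v (T := fun v => exists M, forall N, (M <= N)%N ->
  v = \sum_(n <- s N) comp n v)).
  split; first by exists 0%N => N _; rewrite big1// => i _; rewrite linear0.
  move=> a u w [M hM] [M' hM']; exists (maxn M M') => N.
  rewrite geq_max => /andP[/hM uE /hM' wE]; under eq_bigr do rewrite linearP.
  by rewrite big_split /= -scaler_sumr -uE -wE.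
move=> x [n Wx]; exists (absz n).+1 => N nN.
have ns : n \in s N.
  by apply/mapP; exists (absz (n + N%:Z)); rewrite ?mem_iota; lia.
rewrite (bigD1_seq n)//= (comp_id G Wx) big1 ?addr0// => m mn.
by rewrite (comp_neq G Wx)// eq_sym.
Qed.

(** The operator [L 0 - (lam + m)] removes the term of degree [m] and multiplies the one of degree
    [k] by the nonzero scalar [k - m]; the induction is therefore applied to the rescaled terms. *)
Lemma homogeneous_seq T (s : seq int) (f : int -> V) :
  subspace T -> (forall v, T v -> T (L 0 v)) -> uniq s ->
  (forall n, W n (f n)) -> T (\sum_(n <- s) f n) -> forall n, n \in s -> T (f n).
Proof.
move=> lT T0; elim: s f => [//|m s IH] f /= /andP[ms us] Wf Tf.
have Tfs n : n \in s -> T (f n).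
  move=> ns; apply: (@subspaceZr _ _ _ (n - m)%:~R) => //.
    by rewrite intr_eq0 subr_eq0; apply: contraNneq ms => <-.
  apply: (IH (fun n => (n - m)%:~R *: f n)) => //.
    by move=> k; apply: subspaceZ => //; apply: subspace_degree.
  suff -> : \sum_(k <- s) (k - m)%:~R *: f k =
      L 0 (\sum_(k <- m :: s) f k) - (lam + m%:~R) *: \sum_(k <- m :: s) f k.
    by apply: subspaceB => //; [exact: T0|exact: subspaceZ].
  rewrite linear_sum scaler_sumr -sumrB big_cons /= Wf subrr add0r.
  apply: eq_bigr => k _; rewrite Wf -scalerBl; congr (_ *: _).
  by rewrite intrD rmorphN /=; ring.
move=> n; rewrite inE => /predU1P[->|/Tfs//].
move: Tf; rewrite big_cons addrC; apply: subspaceDr => //.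
by apply: subspace_sum => // k ks _; apply: Tfs.
Qed.

Lemma homogeneous T v n :
  subspace T -> (forall v, T v -> T (L 0 v)) -> T v -> T (comp n v).
Proof.
move=> lT T0 Tv; have [s [us vE]] := comp_sum v.
have [ns|ns] := boolP (n \in s).
  rewrite vE in Tv.
  by apply: (homogeneous_seq lT T0 us (f := comp^~ v)) => // k; apply: comp_degree G _ _.
suff -> : comp n v = 0 by case: lT.
rewrite vE linear_sum big_seq big1// => k ks.
by apply: (comp_neq G (comp_degree G k v)); apply: contraNneq ns => <-.
Qed.

Lemma comp_subspace T v : subspace T -> (forall n, T (comp n v)) -> T v.
Proof.
move=> lT Tv; have [s [_ ->]] := comp_sum v.
exact: subspace_sum.
Qed.

Definition stable S := subspace S /\ forall i v, S v -> S (L i v).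

Definition bounded (q : int) S := forall v, S v -> forall n : int, q < n -> comp n v = 0.

Lemma stable_comp S v n : stable S -> S v -> S (comp n v).
Proof. by move=> [lS LS]; apply: homogeneous => // u; apply: LS. Qed.

Lemma stable_sum_space S T : stable S -> stable T -> stable (sum_space S T).
Proof.
move=> [lS LS] [lT LT]; split; first exact: subspace_sum_space.
move=> i _ [x [y [Sx Ty ->]]]; exists (L i x), (L i y).
by rewrite linearD; split; [exact: LS|exact: LT|].
Qed.

Lemma bounded_sum_space q S T :
  bounded q S -> bounded q T -> bounded q (sum_space S T).
Proof.
by move=> bS bT _ [x [y [/bS Sx /bT Ty ->]]] n qn; rewrite linearD Sx// Ty// addr0.
Qed.

Lemma bounded_degree q S v n : bounded q S -> S v -> W n v -> q < n -> v = 0.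
Proof. by move=> bS Sv Wv qn; apply: (comp_eq0 Wv); apply: (bS v). Qed.

Lemma bounded_le q q' S : q <= q' -> bounded q S -> bounded q' S.
Proof. by move=> qq' bS v Sv n q'n; apply: (bS v) => //; apply: le_lt_trans q'n. Qed.

Lemma stable0 : stable (fun v => v = 0).
Proof.
split=> [|i v ->]; last by rewrite linear0.
by split=> // a u v -> ->; rewrite scaler0 addr0.
Qed.

Lemma top_degree S (q p : int) : stable S -> bounded q S ->
  bounded p S \/ exists n v, [/\ p < n, bounded n S, S v, W n v & v <> 0].
Proof.
move=> sS bS; have [pq|qp] := ltP p q; last by left; apply: bounded_le bS.
move: bS; have -> : q = p + `|q - p|%N by lia.
elim: `|q - p|%N => [|k IH] bS; first by rewrite addr0 in bS; left.
have [[v [Sv Wv v0]]|nv] :=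
    pselect (exists v, [/\ S v, W (p + k.+1%:Z) v & v <> 0]).
  by right; exists (p + k.+1%:Z), v; split=> //; lia.
apply: IH => v Sv n kn; have [nk|kn'] := eqVneq n (p + k.+1%:Z); last first.
  by apply: (bS v) => //; move: kn kn'; lia.
apply/eqP; apply: contra_notT nv => /eqP v0; exists (comp n v).
by rewrite -nk; split=> //; [exact: stable_comp|exact: comp_degree G _ _].
Qed.

(** This is [U(n_-) B], where [n_-] is spanned by the [L_(-i)] with [i > 0]; the impredicative form
    serves as its induction principle. *)
Definition lowering_span B v := forall T, subspace T ->
  (forall (i : int) x, 0 < i -> T x -> T (L (- i) x)) -> (forall x, B x -> T x) -> T v.

Lemma lowering_span_subspace B : subspace (lowering_span B).
Proof.
by split=> [T []//|a u v Bu Bv T lT LT BT]; apply: lT.2; [exact: Bu|exact: Bv].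
Qed.

Lemma lowering_span_in B v : B v -> lowering_span B v.
Proof. by move=> Bv T _ _; apply. Qed.

Lemma lowering_span_act B (i : int) v :
  0 < i -> lowering_span B v -> lowering_span B (L (- i) v).
Proof. by move=> i0 Bv T lT LT BT; apply: (LT _ _ i0); exact: Bv. Qed.

Lemma stable_swap T i j v : subspace T ->
  T (L j (L i v)) -> T (L (i + j) v) -> T v -> T (L i (L j v)).
Proof.
move=> lT T1 T2 T3; rewrite (act_swap G).
by apply: subspaceD => //; [apply: subspaceD => //|]; apply: subspaceZ.
Qed.

(* Poincare-Birkhoff-Witt: raising operators can be moved to the right
   of the lowering ones. *)
Lemma stable_lowering_span S B : stable S ->
  (forall x (k : int), B x -> 0 <= k -> sum_space S (lowering_span B) (L k x)) ->
  stable (sum_space S (lowering_span B)).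
Proof.
move=> [lS LS] BL; set T := sum_space _ _ in BL *.
have lT : subspace T by apply: subspace_sum_space lS (lowering_span_subspace B).
have TN (i : int) x : 0 < i -> T x -> T (L (- i) x).
  move=> i0 [y [z [Sy Bz ->]]]; rewrite linearD; exists (L (- i) y), (L (- i) z).
  by split=> //; [exact: LS|exact: lowering_span_act].
split=> // i _ [x [y [Sx By ->]]]; rewrite linearD; apply: subspaceD => //.
  by apply: sum_spacel; [exact: lowering_span_subspace|exact: LS].
have [i0|i0] := ltP i 0; first by rewrite -(opprK i);
  apply: TN; [rewrite oppr_gt0|apply: sum_spacer].
suff [_] : T y /\ forall k : int, 0 <= k -> T (L k y) by apply.
apply: (By (fun y => T y /\ forall k : int, 0 <= k -> T (L k y))).
- split; first by split=> [|k _]; rewrite ?linear0; case: lT.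
  move=> a u v [Tu TLu] [Tv TLv]; split=> [|k k0]; first exact: lT.2.
  by rewrite linearP; apply: lT.2; [exact: TLu|exact: TLv].
- move=> j z j0 [Tz TLz]; split=> [|k k0]; first exact: TN.
  apply: stable_swap => //.
    by apply: (TN _ _ j0); exact: TLz.
  have [kj|kj] := leP 0 (k - j); first exact: TLz.
  have -> : k - j = - (j - k) by ring.
  by apply: TN => //; lia.
- move=> z Bz; split=> [|k k0]; last exact: BL.
  by apply: sum_spacer => //; apply: lowering_span_in.
Qed.

Lemma lowering_span_bounded B q :
  (forall x (n : int), B x -> q < n -> comp n x = 0) -> bounded q (lowering_span B).
Proof.
move=> bB v Bv.
apply: (Bv (fun v => forall n : int, q < n -> comp n v = 0)).
- split=> [n _|a u w bu bw n qn]; first by rewrite linear0.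
  by rewrite linearP bu// bw// scaler0 addr0.
- by move=> i x i0 bx n qn; rewrite comp_act bx ?linear0//; lia.
- by move=> x Bx n; apply: bB.
Qed.

End GradedAction.

(** * Vectors annihilated by the high raising operators *)

Section SingularVectors.
Context {K : numFieldType} {V : lmodType K}.
Variables (L : int -> {linear V -> V}) (h lam : K).
Variable comp : int -> {linear V -> V}.
Hypothesis G : graded_action L h lam comp.
Implicit Types (S T B : V -> Prop).
Local Notation W := (degree_space L lam).

Lemma swap_mod S i j v : stable L S -> i + j != 0 ->
  S (L i v) -> S (L i (L j v) - (j - i)%:~R *: L (i + j) v).
Proof.
move=> [lS LS] ij Sv; rewrite (act_swap G) (cocycle_neq _ ij) scale0r addr0.
by rewrite addrK; apply: LS.
Qed.

(** The scalar by which [L_n L_(-n)] acts on a vector of weight [mu] killed by [L_n]. *)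
Definition vacuum (mu : K) (n : int) : K :=
  - (2 * n%:~R * mu) + (n ^+ 3 - n)%:~R / 12%:R * h.

Lemma vacuumE m n v : W m v ->
  L n (L (- n) v) = L (- n) (L n v) + vacuum (lam + m%:~R) n *: v.
Proof.
move=> Wv; rewrite (act_swap G) subrr Wv scalerA -addrA -scalerDl.
congr (_ + _ *: _); rewrite /vacuum /cocycle opprK eqxx; congr (_ + _).
by rewrite intrD rmorphN /=; ring.
Qed.

Lemma vacuum_cubic mu (n : nat) : vacuum mu n =
  (- 2 * mu - h / 12%:R) * n%:R + 0 * n%:R ^+ 2 + h / 12%:R * n%:R ^+ 3.
Proof. by rewrite /vacuum rmorphB rmorphXn /= -pmulrn; ring. Qed.

Lemma vacuum_eventually mu : ~ (mu = 0 /\ h = 0) ->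
  exists n0, forall n : nat, (n0 <= n)%N -> vacuum mu n != 0.
Proof.
move=> muh; have [|n0 hn] :=
    @eventually_cubic_neq0 K (- 2 * mu - h / 12%:R) 0 (h / 12%:R).
  apply/negPn; rewrite !negb_or !negbK eqxx /= andbC.
  apply/andP => -[/eqP h0 /eqP mu0]; apply: muh.
  have {}h0 : h = 0.
    by apply/eqP; move/eqP: h0; rewrite mulf_eq0 invr_eq0 pnatr_eq0 orbF.
  split=> //; apply/eqP; move/eqP: mu0.
  by rewrite h0 mul0r subr0 mulf_eq0 oppr_eq0 pnatr_eq0.
by exists n0 => n; rewrite vacuum_cubic; apply: hn.
Qed.

(** When the weight grows along with [n], the coefficient of [n ^ 2] is -2, so no exception for
    special [lam] or [h] arises. *)
Lemma vacuum_eventually_diag :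
  exists n0, forall n : nat, (n0 <= n)%N -> vacuum (lam + n%:R) n != 0.
Proof.
have [|n0 hn] :=
    @eventually_cubic_neq0 K (- 2 * lam - h / 12%:R) (- 2) (h / 12%:R).
  by rewrite oppr_eq0 pnatr_eq0 /= orbT.
exists n0 => n /hn; congr (_ != 0); rewrite vacuum_cubic; ring.
Qed.

(* The vectors L_(-bk) L_k^b v all lie in the finite-dimensional V_m; applying
   L_((j+1)k) to a linear dependence with last index j isolates L_k^(j+1) v. *)
Lemma nilpotent_mod S (k m : int) v : stable L S -> 0 < k -> W m v ->
  (forall i : int, k < i -> S (L i v)) -> exists a, S (iter a (L k) v).
Proof.
move=> [lS LS] k0 Wv Sv; apply: contrapT => nS.
pose w b := iter b (L k) v.
have Sw b (i : int) : k < i -> S (L i (w b)).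
  elim: b i => [|b IH] i ki; first exact: Sv.
  rewrite /w iterS -/(w b) (act_swap G) cocycle_neq; last by lia.
  rewrite scale0r addr0; apply: subspaceD => //; first by apply: LS; apply: IH.
  by apply: subspaceZ => //; apply: IH; lia.
have Ww b : W (m + b%:Z * k) (w b).
  elim: b => [|b IH]; first by rewrite mul0r addr0.
  by apply: (degree_act_eq G IH); rewrite -[b.+1]addn1 PoszD; ring.
have [d [e [We eW]]] := degree_fin G m.
pose u (b : 'I_d.+1) := L (- (b.+1%:Z * k)) (w b.+1).
have Wu b : W m (u b) by apply: (degree_act_eq G (Ww _)); ring.
have [A uA] := span_coord (fun b => eW _ (Wu b)).
have [c c0 cA] := dependence A (ltnSn d).
have [j cj jmax] := max_support c0.
pose x (b : 'I_d.+1) := L (j.+2%:Z * k) (u b).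
have xE b : S (x b - (- (b.+1%:Z * k) - j.+2%:Z * k)%:~R
      *: L ((j.+2%:Z - b.+1%:Z) * k) (w b.+1)) \/ (j < b)%N.
  have [jb|bj] := ltnP j b; [by right|left].
  rewrite /x /u.
  have -> : (j.+2%:Z - b.+1%:Z) * k = j.+2%:Z * k + (- (b.+1%:Z * k)) by ring.
  apply: (swap_mod (conj lS LS)); last by apply: Sw; nia.
  by nia.
have Sx : S (x j).
  apply: (subspace_pivot lS cj) => [b bj|].
    have [jb|bj'] := leqP j b.
      by left; apply: jmax; rewrite ltn_neqAle eq_sym bj.
    case: (xE b) => [|/jmax]; [rewrite addrC => xb; right|by left].
    apply: subspaceDr xb => //.
    by apply: subspaceN => //; apply: subspaceZ => //; apply: Sw; nia.
  have -> : \sum_i c 0 i *: x i = L (j.+2%:Z * k) (\sum_i c 0 i *: u i).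
    by rewrite linear_sum; apply: eq_bigr => i _; rewrite linearZ.
  by rewrite uA cA big1 ?linear0// => [|i _]; [case: lS|rewrite mxE scale0r].
case: (xE j) => [|]; last by rewrite ltnn.
move=> /(subspaceDr lS Sx) /(subspaceN lS); rewrite opprK.
have -> : (j.+2%:Z - j.+1%:Z) * k = k by rewrite -[j.+2]addn1 PoszD; ring.
move=> /(subspaceZr lS) Sk; apply: nS; exists j.+2; rewrite iterS.
by apply: Sk; rewrite intr_eq0; nia.
Qed.

(** Outer induction on [k]: for [k = 0] the vector is singular modulo [S], and adjoining its
    lowering span suffices. Otherwise some power [L_(k+1)^a] sends [v] into [S]; an inner induction
    on [a] first adjoins [L_(k+1)^(a-1) v], to which the outer hypothesis applies. *)
Lemma extend_bounded k S v (m q : int) : stable L S -> bounded comp q S ->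
  W m v -> (forall i : int, k%:Z < i -> S (L i v)) ->
  exists S' q', [/\ stable L S', bounded comp q' S',
                    forall x, S x -> S' x & S' v].
Proof.
elim: k S v m q => [|k IH] S v m q sS bS Wv Sv.
  have lB := lowering_span_subspace L (fun x => x = v).
  exists (sum_space S (lowering_span L (fun x => x = v))), (Num.max q m); split.
  - apply: (stable_lowering_span G) => // _ i ->; rewrite le_eqVlt => /predU1P[<-|].
      apply: sum_spacer sS.1 _.
      by rewrite Wv; apply: subspaceZ lB _; apply: lowering_span_in.
    by move=> i0; apply: sum_spacel => //; apply: Sv.
  - apply: bounded_sum_space; first by apply: bounded_le bS; rewrite le_max lexx.
    apply: (lowering_span_bounded G) => _ n -> mn.
    by rewrite (comp_neq G Wv)//; move: mn; rewrite gt_max; lia.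
  - by move=> x Sx; apply: sum_spacel.
  - by apply: sum_spacer sS.1 _; apply: lowering_span_in.
have [a] := nilpotent_mod sS (k := k.+1%:Z) isT Wv Sv.
elim: a S q sS bS Sv => [|a IHa] S q sS bS Sv Sa.
  by exists S, q; split.
have Wa : W (m + a%:Z * k.+1%:Z) (iter a (L k.+1%:Z) v).
  elim: a {IHa Sa} => [|b IHb]; first by rewrite mul0r addr0.
  by apply: (degree_act_eq G IHb); rewrite -[b.+1]addn1 PoszD; ring.
have Sw b (i : int) : k.+1%:Z < i -> S (L i (iter b (L k.+1%:Z) v)).
  elim: b i => [|b IHb] i ki; first exact: Sv.
  rewrite iterS (act_swap G) cocycle_neq; last by lia.
  rewrite scale0r addr0; apply: subspaceD; first by case: sS.
    by apply: sS.2; apply: IHb.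
  by apply: subspaceZ; [case: sS|apply: IHb; lia].
have [|S1 [q1 [sS1 bS1 SS1 S1w]]] := IH _ _ _ _ sS bS Wa.
  move=> i ki; have [->|ik] := eqVneq i k.+1%:Z; first exact: Sa.
  by apply: Sw; lia.
have [|S2 [q2 [sS2 bS2 SS2 S2v]]] := IHa _ _ sS1 bS1 _ S1w.
  by move=> i /Sv /SS1.
by exists S2, q2; split=> // x /SS1 /SS2.
Qed.

(* Top vectors v_j in distinct degrees n_j would give vectors L_(-n_j) v_j in V_0 that
   are linearly independent, since L_(n_j) sends the j-th to a nonzero multiple of v_j
   and kills those of smaller top degree. *)
Lemma uniform_bound : exists p : int, forall S (q : int),
  stable L S -> bounded comp q S -> bounded comp p S.
Proof.
have [d [e [We eW]]] := degree_fin G 0.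
have [n0 vn0] := vacuum_eventually_diag.
apply: contrapT => nb.
have /choice[g gP] : forall p : int, exists t : int * V * (V -> Prop),
    [/\ p < t.1.1, bounded comp t.1.1 t.2, stable L t.2, t.2 t.1.2
      & W t.1.1 t.1.2 /\ t.1.2 <> 0].
  move=> p; apply: contrapT => np; apply: nb; exists p => S q sS bS.
  have [//|[n [v [pn bn Sv Wv v0]]]] := top_degree G p sS bS.
  by case: np; exists (n, v, S).
(* The top degrees increase strictly and start beyond [n0], where [vacuum_eventually_diag] takes
   effect. *)
pose N j := iter j (fun n => (g n).1.1) (g n0).1.1.
pose M j := if j is j'.+1 then N j' else n0%:Z.
have NM j : N j = (g (M j)).1.1 by case: j.
have Nlt i j : (i < j)%N -> N i < N j.
  elim: j => // j IH; rewrite ltnS leq_eqVlt => /predU1P[->|/IH ij].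
    by rewrite (NM j.+1); have [] := gP (M j.+1).
  by apply: lt_trans ij _; rewrite (NM j.+1); have [] := gP (M j.+1).
have Nn j : n0%:Z < N j.
  elim: j => [|j IH]; first by rewrite (NM 0%N); have [] := gP n0.
  exact: lt_trans IH (Nlt _ _ (ltnSn j)).
pose v j := (g (M j)).1.2; pose S j := (g (M j)).2.
have [bS sS Sv Wv v0] : [/\ forall j, bounded comp (N j) (S j),
    forall j, stable L (S j), forall j, S j (v j), forall j, W (N j) (v j)
    & forall j, v j <> 0].
  by split=> j; rewrite /S /v ?NM; have [? ? ? ? []] := gP (M j).
pose u (b : 'I_d.+1) := L (- N b) (v b).
have Wu b : W 0 (u b) by apply: (degree_act_eq G (Wv b)); ring.
have [A uA] := span_coord (fun b => eW _ (Wu b)).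
have [c c0 cA] := dependence A (ltnSn d).
have [j cj jmax] := max_support c0.
have : L (N j) (u j) = 0.
  apply: (subspace_pivot (stable0 L).1 cj (x := fun b => L (N j) (u b))).
    move=> b bj; have [jb|bj'] := leqP j b.
      by left; apply: jmax; rewrite ltn_neqAle eq_sym bj.
    right; apply: (bounded_degree G (bS b) (n := N j)) (Nlt _ _ bj').
      by apply: (sS b).2; apply: (sS b).2.
    by apply: (degree_act_eq G (Wu b)); rewrite add0r.
  have -> : \sum_i c 0 i *: L (N j) (u i) = L (N j) (\sum_i c 0 i *: u i).
    by rewrite linear_sum; apply: eq_bigr => i _; rewrite linearZ.
  by rewrite uA cA big1 ?linear0// => i _; rewrite mxE scale0r.
rewrite /u (vacuumE _ (Wv j)).
have -> : L (N j) (v j) = 0.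
  apply: (bounded_degree G (bS j) (n := N j + N j)); first exact: (sS j).2.
    exact: (degree_act G).
  by have := Nn j; lia.
rewrite linear0 add0r => /eqP; rewrite scaler_eq0 => /orP[|/eqP/v0//].
have [k nk ->] : exists2 k : nat, (n0 <= k)%N & N j = k%:Z.
  by exists (absz (N j)); have := Nn j; lia.
by rewrite -pmulrn (negbTE (vn0 k nk)).
Qed.

End SingularVectors.

(** * Growth of highest weight modules *)

Section Splitting.
Context {K : numFieldType} {V : lmodType K}.
Variables (L : int -> {linear V -> V}) (h lam : K).
Variable comp : int -> {linear V -> V}.
Hypothesis G : graded_action L h lam comp.
Implicit Types (S T B : V -> Prop).
Local Notation W := (degree_space L lam).
Local Notation vacuum := (vacuum h).

(** Commute [L_(N-b)] to the right. Its bracket with [L_(-a)] leads to the product of two linear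
    factors. Its passage through [L_(a-N)] gives a multiple of [L_(a-b) y], which lies in [S] when
    [b < a] and becomes the vacuum scalar times [y] when [a = b]. *)
Lemma two_lowerings_mod S (n y0 : int) (a b N : nat) y :
  stable L S -> W y0 y -> (forall k : int, 0 < k -> S (L k y)) ->
  (0 < b)%N -> (b <= a)%N -> (a + b < N)%N ->
  S (L (N%:Z - b%:Z) (L (- a%:Z) (L (a%:Z - N%:Z) y))
     - ((N%:R + a%:R - b%:R) * (2 * N%:R - 2 * a%:R - b%:R)
        + (a == b)%:R * vacuum (lam + y0%:~R) (N%:Z - b%:Z)) *: L (- b%:Z) y).
Proof.
move=> [lS LS] Wy Sy b0 ba abN.
set x := N%:Z - b%:Z; set z := a%:Z - N%:Z.
have Sxz : S (L x (L z y) - ((a == b)%:R * vacuum (lam + y0%:~R) x) *: y).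
  have [ab|ab] := eqVneq a b.
    have -> : z = - x by rewrite /z /x ab; ring.
    rewrite mul1r (vacuumE G _ Wy) addrK; apply: LS; apply: Sy; rewrite /x; lia.
  rewrite mul0r scale0r subr0 (act_swap G) cocycle_neq; last by rewrite /x /z; lia.
  rewrite scale0r addr0; apply: subspaceD => //.
    by apply: LS; apply: Sy; rewrite /x; lia.
  by apply: subspaceZ => //; apply: Sy; rewrite /x /z; lia.
have S2 : S (L (x - a%:Z) (L z y) - (z - (x - a%:Z))%:~R *: L (- b%:Z) y).
  have -> : - b%:Z = x - a%:Z + z by rewrite /x /z; ring.
  apply: (swap_mod G (conj lS LS)); first by rewrite /x /z; lia.
  by apply: Sy; rewrite /x; lia.
rewrite (act_swap G) cocycle_neq; last by rewrite /x; lia.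
rewrite scale0r addr0.
move: (lS.2 (- a%:Z - x)%:~R _ _ S2 (LS (- a%:Z) _ Sxz)).
set Y := L (- b%:Z) y; set A := L (- a%:Z) (L x (L z y)).
rewrite (linearB (L (- a%:Z))) [L (- a%:Z) (_ *: y)]linearZ /= -/A.
have -> : ((a == b)%:R * vacuum (lam + y0%:~R) x) *: L (- a%:Z) y =
          ((a == b)%:R * vacuum (lam + y0%:~R) x) *: Y.
  by have [->//|_] := eqVneq a b; rewrite mul0r !scale0r.
set al : K := (- a%:Z - x)%:~R.
rewrite scalerBr scalerA addrACA -opprD -scalerDl [_ + A]addrC.
congr (S (_ - _ *: _)); congr (_ + _).
by rewrite /al /z /x !(rmorphB, rmorphN) /= -!pmulrn; ring.
Qed.

(* A dependence sum_a c_a L_(-a) L_(-(N-a)) y is chosen with sum_a c_a a^t = 0 for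
   t < 3: this cancels the part of two_lowerings_mod that is quadratic in a, so that
   the least index b of the support of c is isolated by L_b L_(N-b). *)
Lemma singular_weight0 S U n y D : stable L S -> stable L U -> U y ->
  W n y -> ~ S y -> (forall k : int, 0 < k -> S (L k y)) ->
  (forall m : int, m <= n -> forall r (u : 'I_r -> V),
     (forall i, W m (u i)) -> (forall i, U (u i)) ->
     exists A : 'M[K]_(r, D), forall c : 'rV_r, c *m A = 0 ->
       S (\sum_i c 0 i *: u i)) ->
  lam + n%:~R = 0 /\ h = 0.
Proof.
move=> sS sU Uy Wy nSy Sy dimU; apply: contrapT => /vacuum_eventually[n0 vn0].
(* One vector more than the [D] dimension conditions plus the three moment conditions. All indices
   [a i] and [N - a j] are at least [n0], so the vacuum scalars at both are nonzero. *)
pose r := (D + 3).+1; pose a (i : 'I_r) := (n0.+1 + i)%N.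
pose N := (3 * (n0.+1 + r))%N.
have aN i j : (a i + a j + n0 < N)%N.
  by rewrite /a /N; have := ltn_ord i; have := ltn_ord j; lia.
pose u i := L (- (a i)%:Z) (L ((a i)%:Z - N%:Z) y).
have [|||A uA] := dimU (n - N%:Z) _ r u; first by lia.
- by move=> i; apply: (degree_act_eq G (degree_act G _ Wy)); ring.
- by move=> i; apply: sU.2; apply: sU.2.
pose B := \matrix_(i < r, t < 3) ((a i)%:R ^+ t : K).
have [c c0] := dependence (row_mx A B) (ltnSn _).
rewrite mul_mx_row -row_mx0 => /eq_row_mx[cA cB].
have {}cB t : (t < 3)%N -> \sum_i c 0 i * (a i)%:R ^+ t = 0.
  move=> t3.
  have := congr1 (fun M : 'rV_3 => M 0 (Ordinal t3)) cB; rewrite !mxE; apply: etrans.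
  by apply: eq_bigr => i _; rewrite mxE.
have [j cj jmin] := min_support c0.
pose x := N%:Z - (a j)%:Z; pose Y := L (- (a j)%:Z) y.
pose g i : K := (N%:R + (a i)%:R - (a j)%:R)
                * (2 * N%:R - 2 * (a i)%:R - (a j)%:R).
pose vx := vacuum (lam + n%:~R) x.
have g0 : \sum_i c 0 i * g i = 0.
  pose N' : K := N%:R; pose b : K := (a j)%:R.
  have -> : \sum_i c 0 i * g i =
      (N' - b) * (2 * N' - b) * \sum_i c 0 i * (a i)%:R ^+ 0
      + b * (\sum_i c 0 i * (a i)%:R ^+ 1)
      - 2 * (\sum_i c 0 i * (a i)%:R ^+ 2).
    rewrite !mulr_sumr -big_split -sumrB /=; apply: eq_bigr => i _.
    by rewrite /g -/N' -/b expr0 expr1; ring.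
  by rewrite !cB// !mulr0 addr0 subr0.
have Su : S (L x (\sum_i c 0 i *: u i)) by apply: sS.2; apply: uA.
have SY : S ((c 0 j * vx) *: Y).
  have -> : (c 0 j * vx) *: Y =
     L x (\sum_i c 0 i *: u i)
     - \sum_i c 0 i *: (L x (u i) - (g i + (a i == a j)%:R * vx) *: Y).
    rewrite linear_sum -sumrB.
    under eq_bigr => i _ do rewrite linearZ -scalerBr opprB addrCA subrr addr0
      scalerA mulrDr.
    rewrite -scaler_suml big_split /= g0 add0r (bigD1 j)//= eqxx mul1r.
    rewrite big1 ?addr0// => i ij.
    by rewrite eqn_add2l (inj_eq val_inj) (negbTE ij) mul0r mulr0.
  apply: (subspaceB sS.1) => //; apply: (subspace_sum sS.1) => i _ _.
  have [ij|ji] := ltnP i j; first by rewrite jmin// scale0r; case: sS.1.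
  apply: (subspaceZ _ sS.1); apply: two_lowerings_mod => //.
    by rewrite leq_add2l.
  by have := aN i j; lia.
apply: nSy; suff SLY : S (L (a j)%:Z Y).
  have := SLY; rewrite /Y (vacuumE G _ Wy).
  move=> /(subspaceDr sS.1 (sS.2 _ _ (Sy _ _))) -/(_ isT).
  by apply: (subspaceZr sS.1); apply: vn0; rewrite /a; lia.
apply: sS.2; apply: (subspaceZr sS.1) SY; rewrite mulf_neq0// /vx /x.
have -> : N%:Z - (a j)%:Z = (N - a j)%N%:Z by have := aN j j; lia.
by apply: vn0; have := aN j j; lia.
Qed.

(** Absence of the trivial factor: a [y] outside [S] with all of Vir sending it into [S] would make
    [(S + K y) / S] a copy of [V(0)]. *)
Hypothesis no_trivial : forall S, stable L S -> forall y,
  (forall i, S (L i y)) -> S (h *: y) -> S y.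

(** Adjoin to [S] everything generated downwards by the [L_(-i) y], but not [y] itself. At weight 0
    and [h = 0] raising never returns to [y], so this is stable and contains all [L_i y]; by
    [no_trivial] it contains [y]. The adjoined part lives in degrees below [n], which leaves [y] in
    [S]. *)
Lemma singular_weight0_mem S n y : stable L S -> W n y ->
  (forall k : int, 0 < k -> S (L k y)) -> lam + n%:~R = 0 -> h = 0 -> S y.
Proof.
move=> sS Wy Sy w0 h0.
have L0y : L 0 y = 0 by rewrite Wy w0 scale0r.
pose B x := exists2 i : int, 0 < i & x = L (- i) y.
pose T := sum_space S (lowering_span L B).
have lB := lowering_span_subspace L B.
have BT i : 0 < i -> T (L (- i) y).
  by move=> i0; apply: sum_spacer sS.1 _; apply: lowering_span_in; exists i.
have LT i : T (L i y).
  have [i0|i0|->] := ltgtP i 0; last by rewrite L0y; case: (subspace_sum_space sS.1 lB).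
    by rewrite -(opprK i); apply: BT; rewrite oppr_gt0.
  by apply: sum_spacel lB _; apply: Sy.
have lT : subspace T := subspace_sum_space sS.1 lB.
have sT : stable L T.
  apply: (stable_lowering_span G) => // _ k [i i0 ->] k0.
  rewrite (act_swap G) [cocycle _ _ _]/cocycle h0 mulr0 if_same scale0r addr0.
  apply: (subspaceD lT); last by apply: (subspaceZ _ lT).
  move: k0; rewrite le_eqVlt => /predU1P[<-|k0].
    by rewrite L0y linear0; case: lT.
  by apply: sum_spacel lB _; apply: sS.2; apply: Sy.
have : T y by apply: no_trivial => //; rewrite h0 scale0r; case: lT.
move=> [x [z [Sx Bz yE]]].
have zb : bounded comp (n - 1) (lowering_span L B).
  apply: (lowering_span_bounded G) => _ m [i i0 ->] nm.
  by apply: (comp_neq G (degree_act G _ Wy)); lia.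
rewrite -(comp_id G Wy) yE linearD (zb _ Bz n) ?addr0; last by lia.
exact: (stable_comp G).
Qed.

(** A dimension bound is phrased as [d] linear conditions on the coefficients that force a relation;
    this form also makes sense modulo a subspace. *)
Lemma degree_coord q : exists d, forall r (u : 'I_r -> V),
  (forall i, W q (u i)) -> exists A : 'M[K]_(r, d),
    forall c : 'rV_r, c *m A = 0 -> \sum_i c 0 i *: u i = 0.
Proof.
have [d [e [_ eW]]] := degree_fin G q; exists d => r u Wu.
have [A uA] := span_coord (fun i => eW _ (Wu i)); exists A => c cA.
by rewrite uA cA big1// => i _; rewrite mxE scale0r.
Qed.

Lemma act_semigroup S (n : nat) v : stable L S -> (0 < n)%N ->
  S (L n v) -> S (L n.+1 v) -> exists k : nat, forall i : int, k%:Z < i -> S (L i v).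
Proof.
move=> [lS LS] n0 Sn Sn1.
have [|k kS] := @numerical_semigroup (fun i => S (L i%:Z v)) n n0 Sn Sn1.
  move=> i j ij Si Sj; apply: (@subspaceZr _ _ S (j%:Z - i%:Z)%:~R) => //.
    by rewrite intr_eq0; lia.
  apply: (@subspaceDr _ _ S (L j (L i v))); [by []|exact: LS|].
  have := act_swap G i j v.
  by rewrite cocycle_neq ?scale0r ?addr0 ?PoszD; [move=> <-; apply: LS|lia].
exists k => i ki; have -> : i = (absz i)%:Z by lia.
by apply: kS; lia.
Qed.

(** With [n = q + 1 - m], the pair [(L_n, L_(n+1))] sends degree [m] to degrees [q + 1] and [q + 2].
    A vector killed by both has [L_i v] in [S] for all large [i] by [act_semigroup], hence lies in
    [S]. The bound is thus independent of [m]. *)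
Lemma coord_below S (q : int) : stable L S ->
  (forall (k : nat) m v, W m v -> (forall i : int, k%:Z < i -> S (L i v)) -> S v) ->
  exists D, forall m : int, m <= q -> forall r (u : 'I_r -> V),
    (forall i, W m (u i)) -> exists A : 'M[K]_(r, D),
      forall c : 'rV_r, c *m A = 0 -> S (\sum_i c 0 i *: u i).
Proof.
move=> sS Splus; have [d1 dP1] := degree_coord (q + 1).
have [d2 dP2] := degree_coord (q + 2).
exists (d1 + d2)%N => m mq r u Wu; pose n := absz (q + 1 - m)%R.
have [|A1 uA1] := dP1 r (fun i => L n (u i)).
  by move=> i; apply: (degree_act_eq G (Wu i)); rewrite /n; lia.
have [|A2 uA2] := dP2 r (fun i => L n.+1 (u i)).
  by move=> i; apply: (degree_act_eq G (Wu i)); rewrite /n; lia.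
exists (row_mx A1 A2) => c; rewrite mul_mx_row -row_mx0 => /eq_row_mx[cA1 cA2].
have Lsum k : L k (\sum_i c 0 i *: u i) = \sum_i c 0 i *: L k (u i).
  by rewrite linear_sum; apply: eq_bigr => i _; rewrite linearZ.
have [|||k Sk] := act_semigroup (n := n) (v := \sum_i c 0 i *: u i) sS.
- by rewrite /n; lia.
- by rewrite Lsum uA1//; case: sS.1.
- by rewrite Lsum uA2//; case: sS.1.
apply: (Splus k m _ _ Sk).
by apply: (subspace_sum (subspace_degree _ _ _)) => i _ _;
  apply: subspaceZ => //; apply: subspace_degree.
Qed.

End Splitting.

(** * Splitting off the part bounded above *)

Section Decomposition.
Context {K : numFieldType} {V : lmodType K}.
Variables (L : int -> {linear V -> V}) (h lam : K).
Variable comp : int -> {linear V -> V}.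
Hypothesis G : graded_action L h lam comp.
Hypothesis no_trivial : forall S, stable L S -> forall y,
  (forall i, S (L i y)) -> S (h *: y) -> S y.
Variable p : int.
Hypothesis p_bound : forall S (q : int),
  stable L S -> bounded comp q S -> bounded comp p S.
Implicit Types (S T B : V -> Prop).
Local Notation W := (degree_space L lam).

(** The submodule [P] of the decomposition. A common bound [p] makes this union of bounded
    submodules closed under sums and itself bounded. *)
Definition max_bounded v := exists S, [/\ stable L S, bounded comp p S & S v].

Lemma max_bounded_stable : stable L max_bounded.
Proof.
split; last first.
  by move=> i v [S [sS bS Sv]]; exists S; split=> //; apply: sS.2.
split.
  exists (fun v => v = 0); split=> //; first exact: stable0.
  by move=> v -> n _; rewrite linear0.
move=> a u v [S [sS bS Su]] [T [sT bT Tv]]; exists (sum_space S T).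
split; [exact: stable_sum_space|exact: bounded_sum_space|].
by exists (a *: u), v; split=> //; apply: subspaceZ => //; case: sS.
Qed.

Lemma max_bounded_bounded : bounded comp p max_bounded.
Proof. by move=> v [S [_ bS Sv]]; apply: bS. Qed.

(** Adjoining [v] may raise the bound to some [q], but [p_bound] brings it back to [p]. *)
Lemma max_boundedP (k : nat) m v : W m v ->
  (forall i : int, k%:Z < i -> max_bounded (L i v)) -> max_bounded v.
Proof.
move=> Wv Pv; have [S [q [sS bS _ Sv]]] :=
  extend_bounded G max_bounded_stable max_bounded_bounded Wv Pv.
by exists S; split=> //; apply: p_bound bS.
Qed.

Definition generated_above (q : int) v := forall T, stable L T ->
  (forall (n : int) x, q < n -> W n x -> T x) -> T v.

Lemma generated_above_stable q : stable L (generated_above q).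
Proof.
split=> [|i v gv T sT WT]; last by apply: sT.2; apply: gv.
split=> [T []|a u v gu gv T sT WT]; first by case.
by apply: sT.1.2; [apply: gu|apply: gv].
Qed.

Lemma generated_above_in (q n : int) v : q < n -> W n v -> generated_above q v.
Proof. by move=> qn Wv T _ WT; apply: WT Wv. Qed.

(** Descending induction on the degree: once all higher degrees lie in the sum, a vector outside it
    is singular modulo the sum. Since the low pieces of [V / P] have bounded dimension, its weight
    and [h] vanish, and [singular_weight0_mem] gives a contradiction. *)
Lemma max_bounded_generated (q : int) v : p <= q ->
  sum_space max_bounded (generated_above q) v.
Proof.
move=> pq; set S := sum_space _ _.
have sP := max_bounded_stable; have sC := generated_above_stable q.
have sS : stable L S := stable_sum_space sP sC.
have [D dimP] := coord_below G q sP max_boundedP.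
apply: (comp_subspace G sS.1) => n; move: {v}(comp n v) (comp_degree G n v) => y.
have [k kn] : exists k : nat, q - k%:Z < n by exists (absz (q + 1 - n)%R); lia.
elim: k n kn y => [|k IH] n kn y Wy.
  by apply: sum_spacer sP.1 _; apply: (generated_above_in (n := n)) => //; lia.
have [qkn|nqk] := ltP (q - k%:Z) n; first exact: (IH n).
have Sy (i : int) : 0 < i -> S (L i y).
  by move=> i0; apply: (IH (n + i)); [lia|exact: (degree_act G)].
apply: contrapT => nSy.
have [|||w0 h0] := singular_weight0 G (U := fun=> True) sS _ _ Wy nSy Sy (D := D).
- by split=> //; split.
- by [].
- move=> m mn r u Wu _; have [|A uA] := dimP m _ r u Wu; first by lia.
  by exists A => c /uA; apply: sum_spacel sC.1.
by apply: nSy; apply: (singular_weight0_mem G no_trivial) Sy w0 h0.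
Qed.

(** * Generation of [C] by lowering operators of large index *)

Local Notation C := (generated_above p).

(** [P] vanishes in degrees above [p], so the decomposition at level [q] reduces there to its
    generated part. Hence [C] is generated by arbitrarily high degrees. *)
Lemma generated_above_degree (q n : int) v :
  p <= q -> p < n -> W n v -> generated_above q v.
Proof.
move=> pq pn Wv; have [x [y [Px Cy vE]]] := max_bounded_generated v pq.
rewrite -(comp_id G Wv) vE linearD (max_bounded_bounded Px pn) add0r.
by apply: (stable_comp G) Cy; apply: generated_above_stable.
Qed.

Lemma generated_above_eq (q : int) v : p <= q -> C v -> generated_above q v.
Proof.
move=> pq Cv; apply: Cv; first exact: generated_above_stable.
by move=> n x pn; apply: generated_above_degree.
Qed.

Definition lowered (k : int) := span (fun v =>
  exists (i : int) x, [/\ k <= i, C x & v = L (- i) x]).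

Lemma lowered_in (k i : int) x : k <= i -> C x -> lowered k (L (- i) x).
Proof. by move=> ki Cx; apply: span_in; exists i, x. Qed.

Lemma lowered_subspace k : subspace (lowered k).
Proof. exact: span_subspace. Qed.

Lemma lowered_act (k j : int) v : 0 < k -> 0 <= j -> lowered k v ->
  lowered k (L (- j) v).
Proof.
have [sl sC] := (lowered_subspace k, generated_above_stable p).
move=> k0 j0 Xv; apply: (Xv (fun v => lowered k (L (- j) v))).
  split=> [|a u w Xu Xw]; first by rewrite linear0; case: sl.
  by rewrite linearP; apply: sl.2.
move=> _ [i [x [ki Cx ->]]]; rewrite (act_swap G) cocycle_neq; last by lia.
rewrite scale0r addr0; have -> : - j + - i = - (j + i) by ring.
apply: (subspaceD sl).
  by apply: (lowered_in ki); apply: sC.2.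
by apply: (subspaceZ _ sl); apply: (lowered_in _ Cx); lia.
Qed.

Lemma lowered_comp (k : int) v n : 0 < k -> lowered k v -> lowered k (comp n v).
Proof.
move=> k0; apply: (homogeneous G) (lowered_subspace k) _ => u.
by rewrite -[in L 0]oppr0; apply: lowered_act.
Qed.

Lemma generated_above_homogeneous T : subspace T ->
  (forall m v, W m v -> C v -> T v) -> forall v, C v -> T v.
Proof.
move=> lT WT v Cv; apply: (comp_subspace G lT) => n.
apply: (WT n); first exact: comp_degree G _ _.
by apply: (stable_comp G) Cv; apply: generated_above_stable.
Qed.

(** Generate [C] from degrees above some [q >= m]. These degrees are preserved by raising, so
    lowering operators alone suffice, and an element of degree [m] cannot be a bare generator. *)
Lemma lowered1 v : C v -> lowered 1 v.
Proof.
have sl := lowered_subspace 1; move: v.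
apply: (generated_above_homogeneous sl) => m v Wv Cv.
pose q := Num.max p m; have pq : p <= q by rewrite le_max lexx.
pose B x := exists2 n : int, q < n & W n x.
have sB : stable L (sum_space (fun v => v = 0) (lowering_span L B)).
  apply: (stable_lowering_span G); first exact: stable0.
  move=> x k [n qn Wx] k0; apply: sum_spacer (stable0 L).1 _.
  apply: lowering_span_in; exists (n + k); first by lia.
  exact: (degree_act G).
have [_ [y [-> By]]] : sum_space (fun v => v = 0) (lowering_span L B) v.
  apply: (generated_above_eq pq Cv) => // n x qn Wx.
  by apply: sum_spacer (stable0 L).1 _; apply: lowering_span_in; exists n.
rewrite add0r => vE; subst y.
(* [t] collects the part made of unlowered generators, which is invisible in degree [m]. *)
pose T x := C x /\ exists t, lowered 1 (x - t) /\ forall n, n <= q -> comp n t = 0.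
have sC := generated_above_stable p.
have [_ [t [Xt t0]]] : T v.
  apply: By.
  - split=> [|a u w [Cu [t [Xt t0]]] [Cw [t' [Xt' t0']]]].
      split; first by case: sC.1.
      by exists 0; split=> [|n _]; [rewrite subr0; case: sl|rewrite linear0].
    split; first exact: sC.1.2.
    exists (a *: t + t'); split=> [|n nq]; last first.
      by rewrite linearP t0// t0'// scaler0 addr0.
    by rewrite opprD addrACA -scalerBr; apply: sl.2.
  - move=> i x i0 [Cx _]; split; first exact: sC.2.
    exists 0; split=> [|n _]; last by rewrite linear0.
    by rewrite subr0; apply: (lowered_in _ Cx); lia.
  - move=> x [n qn Wx]; split.
      by apply: (generated_above_in (n := n)) => //; apply: le_lt_trans qn.
    exists x; rewrite subrr; split=> [|k kq]; first by case: sl.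
    by apply: (comp_neq G Wx); apply: contraTneq qn => ->; rewrite -leNgt.
have -> : v = comp m (v - t) by rewrite linearB t0 ?subr0 ?(comp_id G Wv)// le_max lexx orbT.
exact: lowered_comp.
Qed.

Lemma iter_linear (f : {linear V -> V}) a : linear (iter a f).
Proof. by move=> b u v; elim: a => //= a ->; rewrite linearP. Qed.

Lemma iterB (f : {linear V -> V}) a u v :
  iter a f (u - v) = iter a f u - iter a f v.
Proof. by elim: a => //= a ->; rewrite linearB. Qed.

Lemma iterZ (f : {linear V -> V}) a b u : iter a f (b *: u) = b *: iter a f u.
Proof. by elim: a => //= a ->; rewrite linearZ. Qed.

(** Modulo [lowered (k + 1)] only the terms [L_(-k) C] remain, and the hypothesis can be applied
    again to their arguments. *)
Lemma lowered_iter (k : int) v : 0 < k -> (forall v, C v -> lowered k v) ->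
  forall a, C v ->
  exists2 x, C x & lowered (k + 1) (v - iter a (L (- k)) x).
Proof.
move=> k0 CX a Cv.
have [sl sC] := (lowered_subspace (k + 1), generated_above_stable p).
elim: a => [|a [x Cx Xx]]; first by exists v => //; rewrite subrr; case: sl.
have [y Cy Xy] : exists2 y, C y & lowered (k + 1) (x - L (- k) y).
  apply: (CX x Cx (fun x => exists2 y, C y & lowered (k + 1) (x - L (- k) y))).
    split=> [|b u w [y Cy Xy] [z Cz Xz]].
      by exists 0; [case: sC.1|rewrite linear0 subr0; case: sl].
    exists (b *: y + z); first exact: sC.1.2.
    by rewrite linearP opprD addrACA -scalerBr; apply: sl.2.
  move=> _ [i [y [ki Cy ->]]]; have [ik|ik] := eqVneq i k.
    by exists y => //; rewrite ik subrr; case: sl.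
  exists 0; first by case: sC.1.
  by rewrite linear0 subr0; apply: (lowered_in _ Cy); lia.
exists y => //; rewrite iterSr.
have -> : v - iter a (L (- k)) (L (- k) y) =
    v - iter a (L (- k)) x + iter a (L (- k)) (x - L (- k) y).
  by rewrite iterB addrA subrK.
apply: (subspaceD sl) => //; elim: a {Xx} => //= a IH.
by apply: lowered_act => //; lia.
Qed.

Lemma degree_iter (k m : int) a v :
  W m v -> W (m + a%:Z * k) (iter a (L k) v).
Proof.
move=> Wv; elim: a => [|a IH]; first by rewrite mul0r addr0.
by apply: (degree_act_eq G IH); rewrite -[a.+1]addn1 PoszD; ring.
Qed.

Lemma comp_iter (k m : int) a v :
  comp m (iter a (L k) v) = iter a (L k) (comp (m - a%:Z * k) v).
Proof.
elim: a m => [|a IH] m; first by rewrite mul0r subr0.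
rewrite !iterS (comp_act G) IH; congr (L k (iter a _ (comp _ v))).
by rewrite -[a.+1]addn1 PoszD; ring.
Qed.

(* Dual to nilpotent_mod: a functional f on V_m vanishing on [lowered (k + 1)] yields
   the functionals f o L_(-k)^b o L_(bk) on the finite-dimensional V_m, and composing
   a dependence with last index j with L_(-(j+1)k) isolates f o L_(-k)^(j+1). *)
Lemma lowered_step (k : int) : 0 < k -> (forall v, C v -> lowered k v) ->
  forall v, C v -> lowered (k + 1) v.
Proof.
move=> k0 CX; have [sl sC] := (lowered_subspace (k + 1), generated_above_stable p).
apply: (generated_above_homogeneous sl) => m v Wv Cv.
apply: contrapT => nXv; have [d [e [We eW]]] := degree_fin G m.
have [f [flin fX fv]] := separating_functional sl (subspace_degree L lam m) eW Wv nXv.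
have f0 : f 0 = 0 by apply: fX; [case: (subspace_degree L lam m)|case: sl].
have fZ a u : W m u -> f (a *: u) = a * f u.
  move=> Wu; have := flin a u 0 Wu; rewrite addr0 f0 addr0; apply.
  by case: (subspace_degree L lam m).
have Xiter b u : lowered (k + 1) u -> lowered (k + 1) (iter b (L (- k)) u).
  by move=> Xu; elim: b => //= b; apply: lowered_act; lia.
pose t b u := iter b.+1 (L (- k)) (L (b.+1%:Z * k) u).
have Wt b u : W m u -> W m (t b u).
  move=> Wu; have := degree_iter (- k) b.+1 (degree_act G (b.+1%:Z * k) Wu).
  by rewrite /t mulrN addrK.
have tlin b : linear (t b).
  by move=> a u w; rewrite /t linearP iter_linear.
pose A := \matrix_(b < d.+1, i < d) f (t b (e i)).
have [c c0 cA] := dependence A (ltnSn d).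
have ct u : W m u -> \sum_b c 0 b * f (t b u) = 0.
  move=> /eW[a ->].
  have ft b : f (t b (\sum_i a i *: e i)) = \sum_i a i * f (t b (e i)).
    suff [_] : W m (\sum_i a i *: e i) /\
      f (t b (\sum_i a i *: e i)) = \sum_i a i * f (t b (e i)) by [].
    have t0 : t b 0 = 0.
      by have := tlin b (-1) 0 0; rewrite scaler0 addr0 scaleN1r addNr.
    elim/big_rec2: _ => [|i x y _ [Wy fy]].
      by split; [case: (subspace_degree L lam m)|rewrite t0 f0].
    split; first exact: (subspace_degree L lam m).2.
    by rewrite tlin flin ?fy//; apply: Wt.
  under eq_bigr do rewrite ft mulr_sumr.
  rewrite exchange_big big1// => i _ /=.
  transitivity (a i * (c *m A) 0 i); last by rewrite cA mxE mulr0.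
  rewrite mxE mulr_sumr; apply: eq_bigr => b _.
  by rewrite mxE mulrCA.
have [j cj jmax] := max_support c0.
(* The residual lowering index [M - (b+1) k] equals [k] for [b = j] and exceeds [k] for [b < j]; the
   latter terms are killed by [f]. *)
pose M := j.+2%:Z * k.
have fj x : C x -> W (m + M) x -> f (iter j.+2 (L (- k)) x) = 0.
  move=> Cx Wx; pose y := L (- M) x.
  have Wy : W m y by apply: (degree_act_eq G Wx); rewrite addrK.
  have tX b : (b <= j)%N -> lowered (k + 1) (t b y -
      (- M - b.+1%:Z * k)%:~R *: iter b.+1 (L (- k)) (L (- (M - b.+1%:Z * k)) x)).
    move=> bj; rewrite /t /y (act_swap G) cocycle_neq; last by rewrite /M; nia.
    rewrite scale0r addr0 -iterZ -iterB; apply: Xiter.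
    have -> : b.+1%:Z * k + - M = - (M - b.+1%:Z * k) by ring.
    rewrite addrK; apply: lowered_in; [rewrite /M; nia|exact: sC.2].
  have tlow b : (b < j)%N -> f (t b y) = 0.
    move=> bj; apply: fX; first exact: Wt.
    have := tX b (ltnW bj); rewrite [X in lowered _ X]addrC; apply: (subspaceDr sl).
    apply: (subspaceN sl); apply: (subspaceZ _ sl); apply: Xiter.
    by apply: (lowered_in _ Cx); rewrite /M; nia.
  have := ct y Wy; rewrite (bigD1 j)//= big1 ?addr0 => [|b bj]; last first.
    have [jb|bj'] := leqP j b; last by rewrite tlow ?mulr0.
    by rewrite jmax ?mul0r// ltn_neqAle eq_sym bj.
  move=> /eqP; rewrite mulf_eq0 (negbTE cj) /= => /eqP ftj.
  have := tX j (leqnn j).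
  have -> : M - j.+1%:Z * k = k by rewrite /M -[j.+2]addn1 PoszD; ring.
  rewrite -iterSr; set w := iter _ _ _; set al : K := _%:~R => Xw.
  have Ww : W m w.
    have := degree_iter (- k) j.+2 Wx; rewrite -/w.
    by have -> : m + M + j.+2%:Z * - k = m by rewrite /M; ring.
  have al0 : al != 0 by rewrite /al intr_eq0 /M; nia.
  have Wal : W m (- al *: w) by apply: subspaceZ => //; apply: subspace_degree.
  have : f (1 *: t j y + - al *: w) = 0.
    apply: fX; last by rewrite scale1r scaleNr.
    by apply: (subspace_degree L lam m).2 => //; apply: Wt.
  rewrite flin// ?ftj ?mulr0 ?add0r; last exact: Wt.
  by rewrite fZ// => /eqP; rewrite mulf_eq0 oppr_eq0 (negbTE al0) => /eqP.
(* Modulo the kernel of [f], [v] is an iterate on which [f] vanishes by [fj], against [f v != 0]. *)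
have [x Cx Xx] := lowered_iter k0 CX j.+2 Cv.
pose x' := comp (m + M) x.
have Cx' : C x' by apply: (stable_comp G) Cx.
have Wx' : W (m + M) x' by apply: comp_degree G _ _.
have Xx' : lowered (k + 1) (v - iter j.+2 (L (- k)) x').
  have k10 : 0 < k + 1 by lia.
  have := lowered_comp m k10 Xx; rewrite linearB (comp_id G Wv) comp_iter.
  by have -> : m - j.+2%:Z * - k = m + M by rewrite /M; ring.
have Wi : W m (iter j.+2 (L (- k)) x').
  have := degree_iter (- k) j.+2 Wx'.
  by have -> : m + M + j.+2%:Z * - k = m by rewrite /M; ring.
case/eqP: fv; rewrite -[v](subrK (iter j.+2 (L (- k)) x')) -[X in f (X + _)]scale1r.
rewrite flin ?fj ?addr0//.
  rewrite fX ?mulr0//.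
all: by apply: subspaceB => //; apply: subspace_degree.
Qed.

Lemma lowered_all (k : nat) v : C v -> lowered k.+1 v.
Proof.
elim: k v => [|k IH]; first exact: lowered1.
have -> : k.+2%:Z = k.+1%:Z + 1 by lia.
exact: lowered_step.
Qed.

(** Dual to [coord_below]. The indices [i] with [L_(-i) C] inside [L_(-n) C + L_(-n-1) C] include
    all large ones, so by [lowered_all] this sum is all of [C]. In degree [m] it is covered by the
    images of degrees [p + 1] and [p + 2]. *)
Lemma generated_above_coord :
  exists D, forall m : int, m <= p -> forall r (u : 'I_r -> V),
    (forall i, W m (u i)) -> (forall i, C (u i)) ->
    exists A : 'M[K]_(r, D),
      forall c : 'rV_r, c *m A = 0 -> \sum_i c 0 i *: u i = 0.
Proof.
have [d1 [e1 [_ eW1]]] := degree_fin G (p + 1).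
have [d2 [e2 [_ eW2]]] := degree_fin G (p + 2).
exists (d1 + d2)%N => m mp r u Wu Cu; pose n := absz (p + 1 - m)%R.
have sC := generated_above_stable p.
pose Z v := exists x y, [/\ C x, C y & v = L (- n%:Z) x + L (- n.+1%:Z) y].
have sZ : subspace Z.
  split=> [|a _ _ [x [y [Cx Cy ->]]] [x' [y' [Cx' Cy' ->]]]].
    by exists 0, 0; rewrite !linear0 addr0; split=> //; case: sC.1.
  exists (a *: x + x'), (a *: y + y'); split; [exact: sC.1.2|exact: sC.1.2|].
  by rewrite !linearP scalerDr addrACA.
have [||||k kJ] := @numerical_semigroup
    (fun i => forall x, C x -> Z (L (- i%:Z) x)) n.
- by rewrite /n; lia.
- by move=> x Cx; exists x, 0; rewrite linear0 addr0; split=> //; case: sC.1.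
- by move=> x Cx; exists 0, x; rewrite linear0 add0r; split=> //; case: sC.1.
- move=> i j ij Zi Zj x Cx.
  apply: (@subspaceZr _ _ Z (i%:Z - j%:Z)%:~R) => //.
    by rewrite intr_eq0; lia.
  apply: (@subspaceDr _ _ Z (L (- j%:Z) (L (- i%:Z) x))); [by []| |].
    by apply: Zj; apply: sC.2.
  have := act_swap G (- i%:Z) (- j%:Z) x.
  rewrite cocycle_neq ?scale0r ?addr0; last by lia.
  have -> : - i%:Z + - j%:Z = - (i + j)%N%:Z by lia.
  have -> : - j%:Z - - i%:Z = i%:Z - j%:Z by ring.
  by move=> <-; apply: Zi; apply: sC.2.
have CZ v : C v -> Z v.
  move=> Cv; have Xv : lowered k.+1 v := lowered_all Cv; apply: Xv => // _ [i [x [ki Cx ->]]].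
  have -> : i = (absz i)%:Z by lia.
  by apply: kJ => //; lia.
pose g (l : 'I_(d1 + d2)) := match split l with
  | inl l1 => L (- n%:Z) (e1 l1) | inr l2 => L (- n.+1%:Z) (e2 l2) end.
have [|A uA] := @span_coord K V r _ g u; last first.
  by exists A => c cA; rewrite uA cA big1// => l _; rewrite mxE scale0r.
move=> i; have [x [y [Cx Cy uE]]] := CZ _ (Cu i).
have /eW1[a aE] : W (p + 1) (comp (p + 1) x) by apply: comp_degree G _ _.
have /eW2[b bE] : W (p + 2) (comp (p + 2) y) by apply: comp_degree G _ _.
exists (fun l => match split l with inl l1 => a l1 | inr l2 => b l2 end).
rewrite big_split_ord /= -(comp_id G (Wu i)) uE linearD !(comp_act G).
have -> : m - - n%:Z = p + 1 by rewrite /n; lia.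
have -> : m - - n.+1%:Z = p + 2 by rewrite /n; lia.
rewrite aE bE !linear_sum; congr (_ + _); apply: eq_bigr => l _;
  rewrite linearZ /g.
  by have := unsplitK (inl l : 'I_d1 + 'I_d2); rewrite /unsplit => ->.
by have := unsplitK (inr l : 'I_d1 + 'I_d2); rewrite /unsplit => ->.
Qed.

(** A nonzero intersection is bounded above and has a nonzero top vector, killed by all raising
    operators. The bounded dimensions of [C] in low degrees force its weight and [h] to be 0, and
    [no_trivial] then excludes it. *)
Lemma max_bounded_disjoint v : max_bounded v -> C v -> v = 0.
Proof.
have [sP sC] := (max_bounded_stable, generated_above_stable p).
pose S v := max_bounded v /\ C v; move=> Pv Cv; have Sv : S v by [].
have sS : stable L S.
  split=> [|i u [Pu Cu]]; last by split; [exact: sP.2|exact: sC.2].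
  split; first by split; [case: sP.1|case: sC.1].
  by move=> a u w [Pu Cu] [Pw Cw]; split; [exact: sP.1.2|exact: sC.1.2].
have bS q : bounded comp q max_bounded -> bounded comp q S.
  by move=> bP u [Pu _]; apply: bP.
apply: (comp_subspace G (stable0 L).1) => n1; apply: contrapT => v0.
have [b|[n [y [_ bn Sy Wy y0]]]] := top_degree G (n1 - 1) sS (bS _ max_bounded_bounded).
  by apply: v0; apply: (b v Sv); lia.
have np : n <= p.
  rewrite leNgt; apply/negP => pn; apply: y0.
  by have [Py _] := Sy; apply: (bounded_degree G max_bounded_bounded Py Wy pn).
have Ly (k : int) : 0 < k -> L k y = 0.
  move=> k0; apply: (bounded_degree G bn (n := n + k)); last by lia.
    exact: sS.2.
  exact: (degree_act G).
have [D dimC] := generated_above_coord.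
have [w0 h0] : lam + n%:~R = 0 /\ h = 0.
  apply: (singular_weight0 G (stable0 L) sC (proj2 Sy) Wy y0 Ly (D := D)) => m mn r u Wu Cu.
  by apply: (dimC m) => //; apply: le_trans mn np.
by apply: y0; apply: (singular_weight0_mem G no_trivial (stable0 L) Wy Ly w0 h0).
Qed.

End Decomposition.

Lemma bounded_decomposition (K : numFieldType) (V : lmodType K)
    (L : int -> {linear V -> V}) (h lam : K) (comp : int -> {linear V -> V}) :
  graded_action L h lam comp ->
  (forall S : V -> Prop, stable L S -> forall y,
     (forall i, S (L i y)) -> S (h *: y) -> S y) ->
  exists P C : V -> Prop,
    [/\ stable L P, stable L C, (exists p, bounded comp p P),
        forall v, sum_space P C v & forall v, P v -> C v -> v = 0] /\
    forall k m v, degree_space L lam m v ->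
      (forall i : int, k%:Z < i -> P (L i v)) -> P v.
Proof.
move=> G nt; have [p pb] := uniform_bound G.
exists (max_bounded L comp p), (generated_above L lam p); split; last first.
  exact: (max_boundedP G pb).
split.
- exact: max_bounded_stable.
- exact: generated_above_stable.
- by exists p; apply: max_bounded_bounded.
- by move=> v; apply: (max_bounded_generated G nt pb).
- by move=> v; apply: (max_bounded_disjoint G nt pb).
Qed.

(** * Harish-Chandra modules *)

Lemma pack_linear (K : nzRingType) (U V : lmodType K) (f : U -> V) :
  linear f -> exists g : {linear U -> V}, g =1 f.
Proof.
move=> lf; pose fL := GRing.isLinear.Build K U V _ f lf.
by exists (HB.pack_for {linear U -> V} f fL).
Qed.

(** The projections come from decompositions picked by choice; uniqueness of components makes them
    linear. *)
Lemma direct_sum_projections (K : numFieldType) (V : lieModType (vir K))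
    (W : K -> V -> Prop) :
  (forall l, subspace (W l)) -> internal_direct_sum W ->
  exists pr : K -> {linear V -> V},
    [/\ forall l v, W l (pr l v), forall l v, W l v -> pr l v = v,
        forall l m v, W l v -> l != m -> pr m v = 0
      & forall v, exists s : seq K, v = \sum_(l <- s) pr l v].
Proof.
move=> lW [decV uniqV].
have /choice[t tP] : forall v, exists t : seq K * (K -> V),
    [/\ uniq t.1, forall l, W l (t.2 l) & v = \sum_(l <- t.1) t.2 l].
  by move=> v; have [s [f ?]] := decV v; exists (s, f).
pose pr l v := if l \in (t v).1 then (t v).2 l else 0.
have W0 l : W l 0 by case: (lW l).
have prW l v : W l (pr l v) by rewrite /pr; case: ifP => // _; case: (tP v).
have prE v (s : seq K) : uniq s -> {subset (t v).1 <= s} ->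
    v = \sum_(l <- s) pr l v.
  move=> us ts; have [ut _ {1}->] := tP v.
  rewrite /pr -big_mkcond -[RHS]big_filter; apply: perm_big.
  apply: uniq_perm; rewrite ?filter_uniq// => l; rewrite mem_filter.
  by case: (boolP (l \in _)) => // /ts ->.
have pr_uniq v (f : K -> V) (s : seq K) : uniq s -> (forall l, W l (f l)) ->
    v = \sum_(l <- s) f l -> (forall l, l \notin s -> f l = 0) ->
    forall l, pr l v = f l.
  move=> us Wf vE fs l; pose s' := undup (s ++ (t v).1).
  have sub_s' : {subset (t v).1 <= s'}.
    by move=> k; rewrite mem_undup mem_cat orbC => ->.
  have us' : uniq s' by rewrite undup_uniq.
  have vE' : v = \sum_(k <- s') f k.
    rewrite vE [RHS](bigID (mem s))/= [X in _ + X]big1 ?addr0; last first.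
      by move=> k /fs.
    rewrite -[RHS]big_filter; apply: perm_big; apply: uniq_perm => //.
      by rewrite filter_uniq.
    move=> k; rewrite mem_filter mem_undup mem_cat.
    by case: (k \in s).
  have [ls'|] := boolP (l \in s').
    apply/eqP; rewrite -subr_eq0; apply/eqP.
    apply: (uniqV s' (fun k => pr k v - f k)) => // [k|].
      exact: subspaceB.
    by rewrite sumrB -prE// -vE' subrr.
  rewrite mem_undup mem_cat negb_or => /andP[/fs -> /negbTE lt].
  by rewrite /pr lt.
have pr_lin l : linear (pr l).
  move=> a u v; pose s := undup ((t u).1 ++ (t v).1).
  have us : uniq s by rewrite undup_uniq.
  apply: (pr_uniq _ (fun l => a *: pr l u + pr l v) s us).
  - by move=> k; apply: (lW k).2.
  - rewrite big_split -scaler_sumr -!prE//.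
    + by move=> k; rewrite mem_undup mem_cat orbC => ->.
    + by move=> k; rewrite mem_undup mem_cat => ->.
  - move=> k; rewrite mem_undup mem_cat negb_or => /andP[/negbTE ku /negbTE kv].
    by rewrite /pr ku kv scaler0 addr0.
have /choice[g gE] := fun l => pack_linear (pr_lin l).
have gW m l v : W l v -> g m v = if m == l then v else 0.
  move=> Wv; rewrite gE.
  apply: (pr_uniq v (fun m => if m == l then v else 0) [:: l]) => //.
  - by move=> k; case: eqP => // ->.
  - by rewrite big_seq1 eqxx.
  - by move=> k; rewrite inE => /negbTE ->.
exists g; split.
- by move=> l v; rewrite gE.
- by move=> l v Wv; rewrite (gW l l)// eqxx.
- by move=> l m v Wv lm; rewrite (gW m l)// eq_sym (negbTE lm).
- move=> v; exists (t v).1; rewrite {1}(prE v (t v).1)//; last by case: (tP v).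
  by apply: eq_bigr => l _; rewrite gE.
Qed.

Lemma vir_ind (K : numFieldType) (T : vir K -> Prop) : subspace T ->
  (forall i, T (virL K i)) -> T (virC K) -> forall x, T x.
Proof.
move=> lT TL TC x; rewrite [x]monalgE; apply: (subspace_sum lT) => k _ _.
have -> : << x@_k *g k >> = x@_k *: << k >> :> vir K.
  by apply/malgP => j; rewrite mcoeffZ !mcoeffU mulrnAr mulr1.
by apply: (subspaceZ _ lT); case: k => [i|]; [exact: TL|exact: TC].
Qed.

Section VirasoroModule.
Context {K : numFieldType} {V : lieModType (vir K)}.
Implicit Types (S : V -> Prop).

Definition vir_op (i : int) : {linear V -> V} := lie_act (virL K i).

Lemma lie_act0l (v : V) : lie_act (0 : vir K) v = 0.
Proof. by have := lie_act_linearl v (-1) 0 0; rewrite scaler0 addr0 scaleN1r addNr. Qed.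

Lemma lie_actZl a (x : vir K) (v : V) : lie_act (a *: x) v = a *: lie_act x v.
Proof. by have := lie_act_linearl v a x 0; rewrite addr0 lie_act0l addr0. Qed.

Variable h : K.
Hypothesis V_h : central_charge V h.

Lemma vir_op_swap i j (v : V) : vir_op i (vir_op j v) =
  vir_op j (vir_op i v) + (j - i)%:~R *: vir_op (i + j) v + cocycle h i j *: v.
Proof.
have := lie_act_bracket (virL K i) (virL K j) v.
rewrite -[lie_bracket _ _]/(vir_bracket _ _) vir_bracketLL lie_act_linearl.
rewrite !lie_actZl V_h scalerA => /eqP; rewrite eq_sym subr_eq => /eqP.
rewrite /vir_op /= => ->; rewrite [LHS]addrC addrA.
congr (_ + _ *: _).
by rewrite /cocycle; case: ifP => _ //; rewrite mul0r.
Qed.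

Lemma stable_act S x v : stable vir_op S -> S v -> S (lie_act x v).
Proof.
move=> [lS LS] Sv.
apply: (vir_ind (T := fun x => S (lie_act x v))) => [|i|].
- split=> [|a y z Sy Sz]; first by rewrite lie_act0l; case: lS.
  by rewrite lie_act_linearl; apply: lS.2.
- exact: (LS i).
- by rewrite V_h; apply: subspaceZ.
Qed.

Definition submodule_of S (sS : stable vir_op S) : submodule V :=
  Submodule sS.1.1 sS.1.2 (fun x v => @stable_act S x v sS).

End VirasoroModule.

(** * Trivial composition factors *)

Section TrivialFactor.
Context {K : numFieldType} {V : lieModType (vir K)}.
Variables (A B : submodule V) (y : V).
Hypotheses (AE : forall v, A v <-> exists a, B (v - a *: y)) (By : ~ B y)
  (BA : forall x v, A v -> B (lie_act x v)).

Let subB : subspace B := conj (submodule0 B) (@submoduleP _ _ _ B).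

Lemma trivial_coord_uniq v a b : B (v - a *: y) -> B (v - b *: y) -> a = b.
Proof.
move=> Ba Bb; apply: contrapT => /eqP ab; apply: By.
apply: (@subspaceZr _ _ B (b - a)) => //; first by rewrite subr_eq0 eq_sym.
have -> : (b - a) *: y = (v - a *: y) - (v - b *: y).
  by rewrite opprB [RHS]addrC addrA subrK scalerBl.
exact: subspaceB.
Qed.

Local Notation Q := (subquotient A B).

(** The hypotheses say [A = B + K y] with Vir mapping [A] into [B]; the coefficient of [y] modulo
    [B] is the isomorphism onto the base field. *)
Lemma subquotient_trivial : simple_module Q /\
  lie_isomorphic Q (trivial_module (vir K)).
Proof.
have Aval (u : submod_type A) : A (val u) by apply/asboolP; exact: (valP u).
have /choice[f fP] : forall q : Q, exists a, B (val (repr q) - a *: y).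
  by move=> q; apply/AE.
have fpi (u : submod_type A) a : B (val u - a *: y) ->
    f (quotmod_pi (restrict_submodule A B) u) = a.
  move=> Ba; apply: trivial_coord_uniq (fP _) _.
  have := quotmod_repr_sub (restrict_submodule A B) u.
  rewrite /= => Br; have := subspaceD subB Br Ba.
  by rewrite addrA subrK.
have flin : linear (f : Q -> (trivial_module (vir K) : lmodType K)).
  move=> a p q; rewrite -[p]quotmod_reprK -[q]quotmod_reprK.
  rewrite -quotmod_pi_linear (fpi _ _ (fP p)) (fpi _ _ (fP q)).
  apply: fpi; rewrite linearP /=.
  have -> : a *: val (repr p) + val (repr q) - (a *: (f p : K^o) + f q) *: y =
     a *: (val (repr p) - f p *: y) + (val (repr q) - f q *: y).
    by rewrite scalerBr scalerA addrACA -opprD -scalerDl.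
  by apply: subB.2.
have [g gE] := pack_linear flin.
have Ay a : A (a *: y) by apply/AE; exists a; rewrite subrr; case: subB.
have Ain a : a *: y \in Defs.sub_mem A by apply/asboolP.
pose k (a : trivial_module (vir K)) : Q :=
  quotmod_pi (restrict_submodule A B) (Sub (a *: y) (Ain a)).
have gK : cancel g k.
  move=> q; rewrite /k gE -[RHS]quotmod_reprK; apply/quotmod_piP.
  by have := subspaceN subB (fP q); rewrite opprB.
have kK : cancel k g.
  move=> a; rewrite gE; apply: fpi => /=; rewrite subrr; by case: subB.
have gbij : bijective g by exists k.
split; last first.
  exists g; split=> // x q; rewrite /lie_act/= gE -[q]quotmod_reprK.
  rewrite quotmod_actE; apply: fpi; rewrite scale0r subr0.
  by apply: BA.
split.
  exists (k 1); apply: contra_notN _ (_ : ~ ((1 : K) = 0)); last exact/eqP/oner_neq0.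
  by move=> /eqP k0; rewrite -[LHS]kK k0 linear0.
move=> D; have [D0|nD0] := pselect (forall q, D q -> q = 0).
  left; apply/seteqP; split=> q //=; first exact: D0.
  by move=> ->; apply: submodule0.
right; apply/seteqP; split=> q //= _.
have [q0 [Dq0 q00]] : exists q0, D q0 /\ q0 <> 0.
  by apply: contrapT => nq; apply: nD0 => q' Dq'; apply: contrapT => q'0; apply: nq; exists q'.
have g0 : (g q0 : K) != 0.
  by apply/eqP => g0; apply: q00; rewrite -[LHS]gK g0 -[in k _](linear0 g) gK.
have -> : q = (g q / g q0 : K) *: q0 + 0.
  apply: (bij_inj gbij); rewrite addr0 linearZ /=.
  by rewrite /GRing.scale /= divfK.
by apply: submoduleP => //; apply: submodule0.
Qed.

End TrivialFactor.

Lemma no_trivial_factor (K : numFieldType) (V : lieModType (vir K)) (h : K) :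
  central_charge V h -> ~ composition_factor V (trivial_module (vir K)) ->
  forall S, stable vir_op S -> forall y : V,
    (forall i, S (vir_op i y)) -> S (h *: y) -> S y.
Proof.
move=> V_h ncf S sS y Sy Shy; apply: contrapT => nSy; apply: ncf.
pose T v := exists a, S (v - a *: y).
have lT : subspace T.
  split; first by exists 0; rewrite scale0r subr0; case: sS.1.
  move=> a u v [b Sb] [c Sc]; exists (a * b + c).
  rewrite scalerDl opprD addrACA -scalerA -scalerBr; exact: sS.1.2.
have sT : stable vir_op T.
  split=> // i v [a Sa]; exists 0; rewrite scale0r subr0.
  have -> : vir_op i v = vir_op i (v - a *: y) + a *: vir_op i y.
    by rewrite linearB linearZ subrK.
  by apply: (subspaceD sS.1); [apply: sS.2|apply: (subspaceZ _ sS.1)].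
have BA x v : T v -> S (lie_act x v).
  move=> [a Sa].
  have -> : lie_act x v = lie_act x (v - a *: y) + a *: lie_act x y.
    by rewrite linearB linearZ subrK.
  apply: (subspaceD sS.1); first by apply: (stable_act V_h).
  apply: (subspaceZ _ sS.1).
  apply: (vir_ind (T := fun x => S (lie_act x y))) => //; last by rewrite V_h.
  split=> [|b z t Sz St]; first by rewrite lie_act0l; case: sS.1.
  by rewrite lie_act_linearl; apply: sS.1.2.
have [] := @subquotient_trivial K V (submodule_of V_h sT) (submodule_of V_h sS) y.
- by move=> v; split.
- by [].
- exact: BA.
move=> simQ isoQ; exists (submodule_of V_h sT), (submodule_of V_h sS); split=> //.
by move=> v Sv; exists 0; rewrite scale0r subr0.
Qed.

(** * The twist exchanging raising and lowering operators *)

Definition flip_op (K : numFieldType) (V : lmodType K)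
  (L : int -> {linear V -> V}) (i : int) : {linear V -> V} := -%R \o L (- i).

Section Flip.
Context {K : numFieldType} {V : lmodType K}.
Variables (L : int -> {linear V -> V}) (h lam : K).
Variable comp : int -> {linear V -> V}.

Lemma degree_space_flip n v :
  degree_space (flip_op L) (- lam) n v <-> degree_space L lam (- n) v.
Proof.
rewrite /degree_space /flip_op /= oppr0 rmorphN /=.
have -> : - lam + n%:~R = - (lam - n%:~R) by ring.
by rewrite scaleNr; split=> [/oppr_inj//|->].
Qed.

(** The map [L_i |-> - L_(-i)], [c |-> - c] is an automorphism of Vir; it negates weights, degrees
    and central charge. *)
Lemma graded_action_flip : graded_action L h lam comp ->
  graded_action (flip_op L) (- h) (- lam) (fun n => comp (- n)).
Proof.
case=> sw cW cid cneq dsp dfin; split.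
- move=> i j v; rewrite /flip_op /= !linearN /= !opprK sw; congr (_ + _ + _ *: _).
    rewrite -scaleNr [- (i + j)]opprD; congr (_ *: _).
    by rewrite -rmorphN /=; congr _%:~R; ring.
  rewrite /cocycle opprK eqr_oppLR; case: ifP => // _.
  by rewrite !(rmorphD, rmorphN, rmorphXn) /=; ring.
- by move=> n v; apply/degree_space_flip.
- by move=> n v /degree_space_flip; apply: cid.
- by move=> m n v /degree_space_flip Wv mn; apply: (cneq _ _ _ Wv); rewrite eqr_opp.
- move=> v T lT WT; apply: (dsp v T lT) => x [n Wx]; apply: WT.
  by exists (- n); apply/degree_space_flip; rewrite opprK.
- move=> n; have [d [e [We eW]]] := dfin (- n).
  exists d, e; split=> [i|v /degree_space_flip]; [exact/degree_space_flip|exact: eW].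
Qed.

Lemma stable_flip S : stable (flip_op L) S <-> stable L S.
Proof.
split=> -[lS LS]; split=> // i v Sv.
  have := LS (- i) v Sv; rewrite /flip_op /= opprK => /(subspaceN lS).
  by rewrite opprK.
by rewrite /flip_op /=; apply: (subspaceN lS); apply: LS.
Qed.

End Flip.

(** * Reduction to one coset of weights, and the case distinction *)

Section HarishChandra.
Context {K : numFieldType} {V : lieModType (vir K)}.
Variable h : K.
Hypotheses (V_hc : harish_chandra V) (V_indec : indecomposable V)
  (V_h : central_charge V h).

Lemma subspace_weight l : subspace (weight_space l : V -> Prop).
Proof.
split; first by rewrite /weight_space /= linear0 scaler0.
move=> a u v; rewrite /weight_space /= => Wu Wv.
by rewrite linearP /= Wu Wv scalerDr !scalerA mulrC.
Qed.

Lemma indecomposable_stable (S T : V -> Prop) :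
  stable vir_op S -> stable vir_op T -> (forall v, sum_space S T v) ->
  (forall v, S v -> T v -> v = 0) ->
  (forall v, S v -> v = 0) \/ (forall v, T v -> v = 0).
Proof.
move=> sS sT ST ST0.
have [] := V_indec.2 (submodule_of V_h sS) (submodule_of V_h sT).
- split=> [v|]; first by have [x [y [Sx Ty ->]]] := ST v; exists x, y.
  apply/seteqP; split=> v /=; first by case; apply: ST0.
  by move=> ->; split; [case: sS.1|case: sT.1].
- by move=> S0; left=> v Sv; have : [set 0]%classic v by rewrite -S0.
- by move=> T0; right=> v Tv; have : [set 0]%classic v by rewrite -T0.
Qed.

(** The weight spaces in [lam + Z] and those outside span complementary submodules. Taking [lam]
    from a nonzero component of some vector makes the first nonzero, so the second vanishes. *)
Lemma indecomposable_graded : exists lam (comp : int -> {linear V -> V}),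
  graded_action vir_op h lam comp /\
  forall l (v : V), weight_space l v -> v <> 0 -> exists n : int, l = lam + n%:~R.
Proof.
have [pr [prW pr_id pr_neq pr_sum]] :=
  direct_sum_projections subspace_weight V_hc.1.
have pr0 v : (forall l, pr l v = 0) -> v = 0.
  by move=> prv; have [s ->] := pr_sum v; rewrite big1.
have act_weight l i (v : V) : weight_space l v -> weight_space (l + i%:~R) (vir_op i v).
  move=> Wv; have Wv' : degree_space vir_op l 0 v.
    by rewrite /degree_space addr0.
  rewrite /weight_space /= -[lie_act _ _]/(vir_op 0 (vir_op i v)).
  rewrite (vir_op_swap V_h) cocycle0l scale0r addr0 Wv' subr0 add0r addr0.
  by rewrite linearZ -scalerDl.
have pr_act l i v : pr l (vir_op i v) = vir_op i (pr (l - i%:~R) v).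
  have [s ->] := pr_sum v; rewrite !linear_sum; apply: eq_bigr => m _.
  have Wm := prW m v; move: (pr m v) Wm => x Wx.
  have [->|mi] := eqVneq l (m + i%:~R).
    by rewrite addrK (pr_id _ _ Wx) pr_id//; apply: act_weight.
  rewrite (pr_neq _ _ _ Wx) ?linear0; last by rewrite eq_sym subr_eq.
  by rewrite (pr_neq _ _ _ (act_weight _ i _ Wx))// eq_sym.
have [[v1 /eqP v10] _] := V_indec.
have [lam prlam] : exists lam, pr lam v1 <> 0.
  by apply: contrapT => nl; apply: v10; apply: pr0 => l; apply: contrapT => ?;
    apply: nl; exists l.
pose cs l := exists n : int, l = lam + n%:~R.
have csD l (i : int) : cs (l - i%:~R) -> cs l.
  move=> [n ln]; exists (n + i); rewrite intrD addrA -ln subrK//.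
have csB l (i : int) : cs l -> cs (l - i%:~R).
  by move=> [n ->]; exists (n - i); rewrite rmorphB addrA.
pose A v := forall l, ~ cs l -> pr l v = 0.
pose B v := forall l, cs l -> pr l v = 0.
have sA : stable vir_op A.
  split=> [|i v Av l nl]; last by rewrite pr_act Av ?linear0// => /csD.
  split=> [l _|a u v Au Av l nl]; first by rewrite linear0.
  by rewrite linearP Au// Av// scaler0 addr0.
have sB : stable vir_op B.
  split=> [|i v Bv l nl]; last by rewrite pr_act Bv ?linear0//; apply: csB.
  split=> [l _|a u v Bu Bv l nl]; first by rewrite linear0.
  by rewrite linearP Bu// Bv// scaler0 addr0.
have homA l (x : V) : weight_space l x -> cs l -> A x.
  by move=> Wx cl m nm; apply: (pr_neq _ _ _ Wx); apply/eqP => lm; apply: nm; rewrite -lm.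
have homB l (x : V) : weight_space l x -> ~ cs l -> B x.
  by move=> Wx cl m nm; apply: (pr_neq _ _ _ Wx); apply/eqP => lm; apply: cl; rewrite lm.
have [||A0|B0] := indecomposable_stable sA sB.
- move=> v; have [s ->] := pr_sum v.
  apply: (subspace_sum (subspace_sum_space sA.1 sB.1)) => l _ _.
  have [cl|ncl] := pselect (cs l).
    by apply: sum_spacel sB.1 _; apply: homA (prW l v) cl.
  by apply: sum_spacer sA.1 _; apply: homB (prW l v) ncl.
- move=> v Av Bv; apply: pr0 => l.
  by have [cl|ncl] := pselect (cs l); [exact: Bv|exact: Av].
- case: prlam; apply: A0; apply: homA (prW lam v1) _.
  by exists 0; rewrite addr0.
have wcs l (v : V) : weight_space l v -> v <> 0 -> cs l.
  by move=> Wv v0; apply: contrapT => ncl; apply: v0; apply: B0; apply: homB Wv ncl.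
exists lam, (fun n => pr (lam + n%:~R)); split=> //; split.
- exact: vir_op_swap.
- by move=> n v; apply: prW.
- by move=> n v; apply: pr_id.
- move=> m n v Wv mn; apply: (pr_neq _ _ _ Wv).
  by rewrite (inj_eq (addrI lam)) eqr_int.
- move=> v T lT WT; have [s ->] := pr_sum v; apply: (subspace_sum lT) => l _ _.
  have [->|/eqP plv] := eqVneq (pr l v) 0; first by case: lT.
  have [n ln] := wcs l _ (prW l v) plv.
  by apply: WT; exists n; rewrite /degree_space -ln; apply: prW.
- move=> n; have [d [e [We eW _]]] := V_hc.2 (lam + n%:~R).
  by exists d, e.
Qed.

Lemma has_dim_le (W : V -> Prop) n D : @has_dim K V W n ->
  (forall r (u : 'I_r -> V), (forall i, W (u i)) ->
     exists A : 'M[K]_(r, D), forall c : 'rV_r, c *m A = 0 ->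
       \sum_i c 0 i *: u i = 0) -> (n <= D)%N.
Proof.
move=> [e [We _ free_e]] WD; rewrite leqNgt; apply/negP => Dn.
have [A uA] := WD n e We; have [c /eqP c0 /uA cA] := dependence A Dn.
apply: c0; apply/rowP => i; rewrite mxE.
exact: (free_e (c 0) cA).
Qed.

Lemma trichotomy : ~ composition_factor V (trivial_module (vir K)) ->
  [\/ uniformly_bounded V, category_O V | category_Om V].
Proof.
move=> ncf; have nt := no_trivial_factor V_h ncf.
have [lam [comp [G wcs]]] := indecomposable_graded.
have G' := graded_action_flip G.
have nt' (S : V -> Prop) : stable (flip_op vir_op) S -> forall y,
    (forall i, S (flip_op vir_op i y)) -> S (- h *: y) -> S y.
  move=> /stable_flip sS y Sy Shy; apply: nt => // [i|].
    have := Sy (- i); rewrite /flip_op /= opprK => /(subspaceN sS.1).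
    by rewrite opprK.
  by move: Shy; rewrite scaleNr => /(subspaceN sS.1); rewrite opprK.
have [P [C [[sP sC [p bP] PC PC0] Pplus]]] := bounded_decomposition G nt.
have [P' [C' [[sP' sC' [p' bP'] PC' PC0'] Pminus]]] := bounded_decomposition G' nt'.
have weight_ex l : @weight_space K V l <> [set 0]%classic ->
    exists (v : V) n, [/\ v <> 0, l = lam + n%:~R & degree_space vir_op lam n v].
  move=> Wl; have [v [Wv v0]] : exists v : V, weight_space l v /\ v <> 0.
    apply: contrapT => nv; apply: Wl; apply/seteqP; split=> v /=.
      by move=> Wv; apply: contrapT => v0; apply: nv; exists v.
    by move=> ->; case: (subspace_weight l).
  have [n ln] := wcs l v Wv v0; exists v, n; split=> //.
  by rewrite /degree_space -ln.
have [P0|C0] := indecomposable_stable sP sC PC PC0; last first.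
  apply: Or32; exists (lam + p%:~R) => l /weight_ex[v [n [v0 -> Wv]]].
  rewrite lerD2l ler_int leNgt; apply/negP => pn; apply: v0.
  have [x [y [Px /C0 -> vE]]] := PC v; rewrite addr0 in vE.
  by apply: (bounded_degree G bP _ Wv pn); rewrite vE.
move/stable_flip in sP'; move/stable_flip in sC'.
have [P'0|C'0] := indecomposable_stable sP' sC' PC' PC0'; last first.
  apply: Or33; exists (lam - p'%:~R) => l /weight_ex[v [n [v0 -> Wv]]].
  rewrite lerD2l -rmorphN /= ler_int leNgt; apply/negP => pn; apply: v0.
  have [x [y [Px /C'0 -> vE]]] := PC' v; rewrite addr0 in vE.
  apply: (bounded_degree G' bP' _ (n := - n)); first by rewrite vE; exact: Px.
    by apply/degree_space_flip; rewrite opprK.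
  by rewrite ltrNr.
apply: Or31.
(* Now [P] and [P'] are both zero, so [coord_below] applies with [S = 0]: directly for degrees at
   most 0, and through the twist for degrees at least 0. *)
have [D1 dim1] := coord_below G 0 (stable0 _)
  (fun k m v Wv Lv => P0 v (Pplus k m v Wv (fun i ki =>
     eq_ind_r P (sP.1.1) (Lv i ki)))).
have [D2 dim2] := coord_below G' 0 (stable0 _)
  (fun k m v Wv Lv => P'0 v (Pminus k m v Wv (fun i ki =>
     eq_ind_r P' (sP'.1.1) (Lv i ki)))).
exists (maxn D1 D2).+1 => // l; have [d dl] := V_hc.2 l; exists d => //.
apply: leqW; rewrite leq_max.
(* A weight outside [lam + Z] has no degree, so zero weight spaces are treated apart. *)
have [Wl0|Wl] := pselect (@weight_space K V l = [set 0]%classic).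
  apply/orP; left; apply: leq_trans (leq0n _).
  apply: (has_dim_le dl) => r u Wu; exists 0 => c _.
  by apply: big1 => i _; have := Wu i; rewrite Wl0 => ->; rewrite scaler0.
have [_ [n [_ ln _]]] := weight_ex l Wl.
have [n0|n0] := leP n 0; apply/orP; [left|right]; apply: (has_dim_le dl) => r u Wu.
  by apply: (dim1 n) => // i; have := Wu i; rewrite /degree_space -ln.
apply: (dim2 (- n)) => [|i]; first by rewrite oppr_le0 ltW.
by apply/degree_space_flip; rewrite opprK /degree_space -ln; apply: Wu.
Qed.

End HarishChandra.

Theorem theorem3 (R : realType) (V : lieModType (vir R[i])) (h : R[i])
    (V_hc : harish_chandra V) (V_indec : indecomposable V)
    (V_h : central_charge V h) :
  [\/ uniformly_bounded V, category_O V, category_Om V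
    | composition_factor V (trivial_module (vir R[i]))].
Proof.
have [cf|ncf] := pselect (composition_factor V (trivial_module (vir R[i]))).
  exact: Or44.
have [ub|cO|cOm] := trichotomy V_hc V_indec V_h ncf.
- exact: Or41.
- exact: Or42.
- exact: Or43.
Qed.
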